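(* Fix a positive integer $\ell$. Let $L$ be the field over $\bar{k}$ generated by $$ S_{\ell}:= \left\{ \left(\frac{1}{1-q^{\ell}}\right)!,\ \left(\frac{2}{1-q^{\ell}}\right)!,\ \ldots,\ \left(\frac{q^{\ell}-2}{1-q^{\ell}}\right)! \right\},$$ where, in the case $q=2$ and $\ell=1$, $S_1$ is interpreted as $\{(-1)!\}$. Then $$\mathrm{tr.deg}_{\bar{k}}\, L=\ell.$$
   Context: Let $q$ be a power of a prime $p$, $\mathbb{F}_q$ the finite field with $q$ elements, $k=\mathbb{F}_q(\theta)$ with $\theta$ a variable, $k_\infty=\mathbb{F}_q((1/\theta))$, $\overline{k_\infty}$ a fixed algebraic closure of $k_\infty$, and $\bar{k}$ the algebraic closure of $k$ in $\overline{k_\infty}$. Arithmetic (Carlitz-Goss) gamma values: put $D_n=\prod_{i=0}^{n-1}(\theta^{q^n}-\theta^{q^i})$ for $n\ge 0$ (so $D_0=1$) and $\overline{D_n}=D_n/\theta^{\deg D_n}$, where $\deg$ is the degree in $\theta$. For $r\in\mathbb{Z}_p$ written as $r=\sum_{i\ge 0} r_i q^i$ with integers $0\le r_i<q$, set $r!=\prod_{i\ge 0}\overline{D_i}^{\,r_i}\in k_\infty$. The rational numbers $c/(1-q^\ell)$ are viewed as elements of $\mathbb{Z}_p$. *)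

(* Defs.v *)
From HB Require Import structures.
From mathcomp Require Import all_boot all_order all_algebra all_field.
From mathcomp Require Import boolp classical_sets.
From mathcomp Require Import mpoly.

Set Implicit Arguments.
Unset Strict Implicit.
Unset Printing Implicit Defensive.

Import GRing.Theory.

Local Open Scope ring_scope.
Local Open Scope classical_set_scope.

(* [a] tends to [l] in [V], where the sets [j (pi ^+ N * R)], [N : nat], form a
   basis of neighbourhoods of [0].  It is used with [V = R = Z_p], [j = id],
   [pi = p], and with [R = F_q[[1/theta]]], [V = Frac R], [pi = 1/theta]. *)
Definition adic_cvg (R : pzRingType) (V : zmodType) (j : R -> V) (pi : R)
    (a : nat -> V) (l : V) : Prop :=
  forall N, exists M, forall n, (M <= n)%N ->
    exists s : R, a n - l = j (pi ^+ N * s).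

Record fps (K : Type) := Fps { fps_coef : nat -> K }.

HB.instance Definition _ (K : Type) := [isNew for @fps_coef K].
HB.instance Definition _ (K : eqType) := [Equality of fps K by <:].
HB.instance Definition _ (K : choiceType) := [Choice of fps K by <:].

Lemma fpsP (K : Type) (f g : fps K) :
  (forall n, fps_coef f n = fps_coef g n) <-> f = g.
Proof.
split=> [|-> //]; case: f g => [f] [g] /= fg.
by congr Fps; apply: functional_extensionality_dep.
Qed.

Section FpsRing.
Variable K : fieldType.
Implicit Types f g h : fps K.

Definition fps_zero : fps K := Fps (fun=> 0).
Definition fps_opp f := Fps (fun n => - fps_coef f n).
Definition fps_add f g := Fps (fun n => fps_coef f n + fps_coef g n).
Definition fpsC (c : K) := Fps (fun n => if n == 0%N then c else 0).
Definition fpsX : fps K := Fps (fun n => (n == 1%N)%:R).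
Definition fps_mul f g :=
  Fps (fun n => \sum_(i < n.+1) fps_coef f i * fps_coef g (n - i)).

Fact fps_addA : associative fps_add.
Proof. by move=> f g h; apply/fpsP => n /=; rewrite addrA. Qed.
Fact fps_addC : commutative fps_add.
Proof. by move=> f g; apply/fpsP => n /=; rewrite addrC. Qed.
Fact fps_add0 : left_id fps_zero fps_add.
Proof. by move=> f; apply/fpsP => n /=; rewrite add0r. Qed.
Fact fps_addN : left_inverse fps_zero fps_opp fps_add.
Proof. by move=> f; apply/fpsP => n /=; rewrite addNr. Qed.

HB.instance Definition _ :=
  GRing.isZmodule.Build (fps K) fps_addA fps_addC fps_add0 fps_addN.

Let trunc m f : {poly K} := \poly_(i < m) fps_coef f i.

Let coef_trunc_mul m f g n : (n < m)%N ->
  (trunc m f * trunc m g)`_n = fps_coef (fps_mul f g) n.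
Proof.
move=> ltnm; rewrite coefM /=; apply: eq_bigr => i _.
rewrite !coef_poly (leq_ltn_trans (leq_subr _ _) ltnm).
by rewrite (leq_trans (ltn_ord i)).
Qed.

Fact fps_mulC : commutative fps_mul.
Proof.
move=> f g; apply/fpsP => n.
by rewrite -!(@coef_trunc_mul n.+1) // mulrC.
Qed.

Fact fps_mulA : associative fps_mul.
Proof.
move=> f g h; apply/fpsP => n.
have eqL u v w : fps_coef (fps_mul u (fps_mul v w)) n
    = (trunc n.+1 u * (trunc n.+1 v * trunc n.+1 w))`_n.
  rewrite coefM /=; apply: eq_bigr => i _.
  rewrite coef_trunc_mul ?ltnS ?leq_subr //.
  by rewrite coef_poly ltn_ord.
by rewrite eqL (fps_mulC (fps_mul _ _)) eqL mulrA mulrC.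
Qed.

Fact fps_mul1 : left_id (fpsC 1) fps_mul.
Proof.
move=> f; apply/fpsP => n /=.
rewrite big_ord_recl /= mul1r subn0 big1 ?addr0 // => i _.
by rewrite mul0r.
Qed.

Fact fps_mulDl : left_distributive fps_mul fps_add.
Proof.
move=> f g h; apply/fpsP => n /=.
by rewrite -big_split /=; apply: eq_bigr => i _; rewrite mulrDl.
Qed.

Fact fps_oner_neq0 : fpsC 1 != 0 :> fps K.
Proof.
apply/eqP => /fpsP /(_ 0%N) /= /eqP.
by rewrite oner_eq0.
Qed.

HB.instance Definition _ := GRing.Zmodule_isComNzRing.Build (fps K)
  fps_mulA fps_mulC fps_mul1 fps_mulDl fps_oner_neq0.

Definition fps_unit : pred (fps K) := fun f => `[< exists g, g * f = 1 >].
Definition fps_inv f : fps K :=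
  if f \in fps_unit then xget f [set g | g * f = 1] else f.

Fact fps_mulV : {in fps_unit, left_inverse 1 fps_inv *%R}.
Proof.
move=> f fU; rewrite /fps_inv fU; case: xgetP => [g _ //|no_inv].
by move/asboolP: fU => [g gf1]; case: (no_inv g).
Qed.
Fact fps_unitP f g : g * f = 1 -> f \in fps_unit.
Proof. by move=> gf1; apply/asboolP; exists g. Qed.
Fact fps_inv_out : {in [predC fps_unit], fps_inv =1 id}.
Proof. by move=> f; rewrite inE /fps_inv => /negbTE ->. Qed.

HB.instance Definition _ := GRing.ComNzRing_hasMulInverse.Build (fps K)
  fps_mulV fps_unitP fps_inv_out.

Fact fps_mulf_eq0 f g : f * g = 0 -> (f == 0) || (g == 0).
Proof.
have ordP h : h != 0 ->
    exists n, fps_coef h n != 0 /\ forall i, (i < n)%N -> fps_coef h i = 0.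
  move=> h0; have exn : exists n, fps_coef h n != 0.
    apply: contrapT => no_n; case/eqP: h0; apply/fpsP => n.
    by apply/eqP; apply: contrapT => /negP hn; apply: no_n; exists n.
  case: (ex_minnP exn) => n hn minn; exists n; split=> // i lt_in.
  by apply/eqP; apply: contraTT lt_in => /minn; rewrite -leqNgt.
move=> fg0; apply: contrapT => /negP; rewrite negb_or => /andP[/ordP + /ordP].
move=> [m [fm f_lt]] [n [gn g_lt]].
move/fpsP/(_ (m + n)%N): fg0 => /= /eqP.
have ltm : (m < (m + n).+1)%N by rewrite ltnS leq_addr.
rewrite (bigD1 (Ordinal ltm)) //= addKn big1 ?addr0.
  by rewrite mulf_eq0 (negbTE fm) (negbTE gn).
move=> i neq_im; have [lt_im|le_mi] := ltnP i m; first by rewrite f_lt ?mul0r.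
rewrite g_lt ?mulr0 // ltn_subLR; last by rewrite -ltnS.
rewrite ltn_add2r ltn_neqAle le_mi andbT.
by apply: contraNneq neq_im => eq_mi; apply/eqP/val_inj.
Qed.

HB.instance Definition _ :=
  GRing.ComUnitRing_isIntegral.Build (fps K) fps_mulf_eq0.

End FpsRing.

(* [Z_p] as the inverse limit of the rings [Z / p ^ n]; the [n]-th component
   is the representative of the class mod [p ^ n] in [0, p ^ n). *)
Definition padic_coherent (p : nat) (x : nat -> int) :=
  forall n, x n = (x n.+1 %% (p ^ n)%N%:Z)%Z.

Record padic_int (p : nat) := PadicInt {
  padic_res : nat -> int;
  padic_resP : `[< padic_coherent p padic_res >] }.

HB.instance Definition _ p := [isSub for @padic_res p].
HB.instance Definition _ p := [Choice of padic_int p by <:].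

Lemma padicP p (x y : padic_int p) :
  (forall n, padic_res x n = padic_res y n) <-> x = y.
Proof.
split=> [xy|-> //]; apply: val_inj.
by apply: functional_extensionality_dep.
Qed.

Section PadicRing.
Variable p : nat.
Implicit Types x y z : padic_int p.

Let mod_mod (a : int) n :
  ((a %% (p ^ n.+1)%N%:Z)%Z %% (p ^ n)%N%:Z)%Z = (a %% (p ^ n)%N%:Z)%Z.
Proof.
have {2}-> := intdiv.divz_eq a (p ^ n.+1)%N%:Z.
by rewrite [X in _ * X](_ : _ = p%:Z * (p ^ n)%N) ?mulrA ?modzMDl // expnS PoszM.
Qed.

Let reduce_coherent (f : nat -> int) :
  (forall n, (f n.+1 = f n %[mod (p ^ n)%N%:Z])%Z) ->
  `[< padic_coherent p (fun n => (f n %% (p ^ n)%N%:Z)%Z) >].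
Proof. by move=> fP; apply/asboolP => n; rewrite mod_mod fP. Qed.

Let resS x n : (padic_res x n.+1 = padic_res x n %[mod (p ^ n)%N%:Z])%Z.
Proof. by rewrite (asboolP _ (padic_resP x) n) modz_mod. Qed.

Let res_mod x n : (padic_res x n %% (p ^ n)%N%:Z)%Z = padic_res x n.
Proof. by rewrite -resS -(asboolP _ (padic_resP x) n). Qed.

Fact padic_const_subproof (c : int) n :
  ((fun=> c) n.+1 = (fun=> c) n %[mod (p ^ n)%N%:Z])%Z.
Proof. by []. Qed.
Fact padic_opp_subproof x n :
  (- padic_res x n.+1 = - padic_res x n %[mod (p ^ n)%N%:Z])%Z.
Proof. by rewrite -modzNm resS modzNm. Qed.
Fact padic_add_subproof x y n :
  (padic_res x n.+1 + padic_res y n.+1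
     = padic_res x n + padic_res y n %[mod (p ^ n)%N%:Z])%Z.
Proof. by rewrite -modzDm !resS modzDm. Qed.
Fact padic_mul_subproof x y n :
  (padic_res x n.+1 * padic_res y n.+1
     = padic_res x n * padic_res y n %[mod (p ^ n)%N%:Z])%Z.
Proof. by rewrite -modzMm !resS modzMm. Qed.

Definition padic_const (c : int) : padic_int p :=
  PadicInt (reduce_coherent (padic_const_subproof c)).
Definition padic_opp x := PadicInt (reduce_coherent (padic_opp_subproof x)).
Definition padic_add x y :=
  PadicInt (reduce_coherent (padic_add_subproof x y)).
Definition padic_mul x y :=
  PadicInt (reduce_coherent (padic_mul_subproof x y)).

Fact padic_addA : associative padic_add.
Proof. by move=> x y z; apply/padicP => n /=; rewrite modzDml modzDmr addrA. Qed.
Fact padic_addC : commutative padic_add.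
Proof. by move=> x y; apply/padicP => n /=; rewrite addrC. Qed.
Fact padic_add0 : left_id (padic_const 0) padic_add.
Proof. by move=> x; apply/padicP => n /=; rewrite modzDml add0r res_mod. Qed.
Fact padic_addN : left_inverse (padic_const 0) padic_opp padic_add.
Proof. by move=> x; apply/padicP => n /=; rewrite modzDml addNr. Qed.
Fact padic_mulA : associative padic_mul.
Proof. by move=> x y z; apply/padicP => n /=; rewrite modzMml modzMmr mulrA. Qed.
Fact padic_mulC : commutative padic_mul.
Proof. by move=> x y; apply/padicP => n /=; rewrite mulrC. Qed.
Fact padic_mul1 : left_id (padic_const 1) padic_mul.
Proof. by move=> x; apply/padicP => n /=; rewrite modzMml mul1r res_mod. Qed.
Fact padic_mulDl : left_distributive padic_mul padic_add.
Proof.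
by move=> x y z; apply/padicP => n /=; rewrite modzMml modzDm mulrDl.
Qed.

HB.instance Definition _ := GRing.isZmodule.Build (padic_int p)
  padic_addA padic_addC padic_add0 padic_addN.
HB.instance Definition _ := GRing.Zmodule_isComPzRing.Build (padic_int p)
  padic_mulA padic_mulC padic_mul1 padic_mulDl.

End PadicRing.

(* The junk value [0] is only taken when [p] divides the denominator of [x]. *)
Definition padic_of_rat (p : nat) (x : rat) : padic_int p :=
  xget 0 [set r : padic_int p | r * (denq x)%:~R = (numq x)%:~R].

Definition is_expansion (p q : nat) (r : padic_int p) (d : nat -> nat) : Prop :=
  (forall i, (d i < q)%N) /\
  adic_cvg id p%:R (fun n => \sum_(i < n) (d i * q ^ i)%N%:R) r.

(* When [q] is a positive power of the prime [p], [r] has exactly one such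
   expansion, so the default value is not used. *)
Definition digits (p q : nat) (r : padic_int p) : nat -> nat :=
  xget (fun=> 0%N) [set d | is_expansion q r d].

Section ArithmeticGamma.
Variable F : finFieldType.

Let q := #|F|.

(* [F_q((1/theta))] is the fraction field of [F_q[[1/theta]]], the variable
   [fpsX F] of the power series ring being [1/theta]. *)
Definition k_inf : fieldType := {fraction fps F}.

Definition k_inf_const (c : F) : k_inf := FracField.tofrac (fpsC c).
Definition theta : k_inf := (FracField.tofrac (fpsX F))^-1.

(* [D n] is a polynomial in [theta], so that [deg] is [(size _).-1]. *)
Definition D (n : nat) : {poly F} := \prod_(i < n) ('X^(q ^ n) - 'X^(q ^ i)).

Definition Dbar (n : nat) : k_inf :=
  (map_poly k_inf_const (D n)).[theta] / theta ^+ (size (D n)).-1.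

(* The value of the convergent product [\prod_(i >= 0) Dbar i ^+ r_i], where the
   [r_i] are the base-[q] digits of [r]. *)
Definition arith_gamma (p : nat) (r : padic_int p) : k_inf :=
  xget 0 [set x | adic_cvg (@FracField.tofrac (fps F)) (fpsX F)
                    (fun n => \prod_(i < n) Dbar i ^+ digits q r i) x].

(* For [q = 2] and [l = 1] the range [1 <= c <= q ^ l - 2] is empty; by
   convention the set is then [{(-1)!}]. *)
Definition gamma_values (p l : nat) : set k_inf :=
  if (q == 2%N) && (l == 1%N) then [set arith_gamma (-1 : padic_int p)]
  else [set arith_gamma (padic_of_rat p (c%:R / (1 - q%:R ^+ l)))
         | c in [set c : nat | (1 <= c <= q ^ l - 2)%N]].

End ArithmeticGamma.

Arguments k_inf_const F c : clear implicits.
Arguments theta F : clear implicits.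
Arguments gamma_values F p l : clear implicits.

Section Transcendence.
Variable E : fieldType.
Implicit Types (A K L : set E) (x : E).

Definition field_gen A : set E :=
  smallest [set K : set E | GRing.divring_closed (mem K)] A.

Definition algebraic_over K x : Prop :=
  exists P : {poly E}, [/\ P != 0, P \is a polyOver (mem K) & root P x].

Definition alg_independent K n (b : 'I_n -> E) : Prop :=
  forall P : {mpoly E[n]}, P \is a mpolyOver n (mem K) -> P.@[b] = 0 -> P = 0.

(* [tr.deg_K L = n]: there is a transcendence basis of [L] over [K] with [n]
   elements. *)
Definition has_trdeg K L (n : nat) : Prop :=
  exists b : 'I_n -> E,
    [/\ forall i, L (b i), alg_independent K b
      & forall x, L x -> algebraic_over (field_gen (K `|` range b)) x].

End Transcendence.

Definition k_rat (F : finFieldType) : set (k_inf F) :=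
  field_gen (range (k_inf_const F) `|` [set theta F]).

Definition kbar (F : finFieldType) (C : fieldType) (iota : k_inf F -> C)
    : set C :=
  [set x | algebraic_over (iota @` @k_rat F) x].

(* Main.v *)
Require Import Defs.
From HB Require Import structures.
From mathcomp Require Import all_boot all_order all_algebra all_field.
From mathcomp Require Import boolp classical_sets.
From mathcomp Require Import mpoly.

(* Put [x = 1 / theta] and [Q = q ^ l].  Every value [(c / (1 - Q))!] is a monomial
   in the products [omega j] of the [Dbar i] with [i = j] mod [l], [j < l].  From
   [Dbar (i + 1) = (1 - x ^ (q ^ (i + 1) - 1)) * Dbar i ^ q] one gets
   [omega (j + 1) = omega_ratio j * omega j ^ q], where [omega_ratio j] is the
   product of the [1 - x ^ (q ^ (i + 1) - 1)] with [i = j] mod [l]; going once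
   around the cycle, [omega j ^ (Q - 1)] is the inverse of a monomial in the
   [omega_ratio i].  So it suffices that the [omega_ratio j] are algebraically
   independent over [F_q(x)].

   This is done by Mahler's method.  The partial products of the monomials in the
   [omega_ratio j] satisfy [v i (n + s) = v i n * phi i s (x ^ Q ^ n)] for
   polynomials [phi i s] in [z].  Suppose [\sum_i c i * v i n] tends to [0], that
   is, is divisible by [x ^ Q ^ n].  Linear algebra gives polynomials [R i] in [z]
   of degree at most [d], not all zero, with [R i = c i * g * phi i K] mod [z ^ N]
   and [N - d] as large as needed.  Then [\sum_i R i (x ^ Q ^ n) * v i n] is a
   polynomial in [x] divisible by [x ^ (N * Q ^ n)], of degree smaller than that
   for large [n], hence zero; but the [v i] satisfy no such relation, because a
   shortest one would yield a rational solution of a functional equation that has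
   none. *)

Set Implicit Arguments.
Unset Strict Implicit.
Unset Printing Implicit Defensive.

Import GRing.Theory.

Local Open Scope ring_scope.

(** * Mahler's method for diagonal systems *)

Lemma horner_neq0_large (A : idomainType) (P : {poly A}) (a : nat -> A) :
  injective a -> P != 0 -> exists n0, forall n, (n0 <= n)%N -> P.[a n] != 0.
Proof.
move=> a_inj P0; apply: contrapT => noN.
have root_beyond n0 : exists n, (n0 <= n)%N /\ root P (a n).
  apply: contrapT => no_n; apply: noN; exists n0 => n le_n.
  by apply/negP => Pn; apply: no_n; exists n.
have many m : exists s : seq nat,
    [/\ size s = m, uniq s & all (root P) (map a s)].
  elim: m => [|m [s [szs us rs]]]; first by exists [::].
  have [n [le_n rn]] := root_beyond (\max_(i <- s) i).+1.
  exists (n :: s); split=> /=; rewrite ?szs ?us ?rn ?rs ?andbT //.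
  apply: contraL le_n => n_s; rewrite -ltnNge ltnS.
  exact: (leq_bigmax_seq (F := id)).
have [s [szs us rs]] := many (size P).
have := max_poly_roots P0 rs; rewrite map_inj_uniq // size_map szs ltnn.
by move=> /(_ us).
Qed.

(** Gaussian elimination without division: an unknown with a nonzero coefficient in the first
    equation is eliminated from the others by cross-multiplication. *)
Lemma homogeneous_system (A : idomainType) (J : eqType) (s : seq J) m
    (f : 'I_m -> J -> A) : (size s < m)%N ->
  exists2 v : 'I_m -> A, (exists i, v i != 0)
    & {in s, forall j, \sum_i v i * f i j = 0}.
Proof.
elim: s m f => [|j0 s IHs] [|m] f //= lt_sm.
  by exists (fun=> 1) => //; exists ord0; apply: oner_neq0.
have [/forallP f0|] := boolP [forall i, f i j0 == 0].
  have [v v0 vs] := IHs m.+1 f (ltnW lt_sm).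
  exists v => // j; rewrite inE => /predU1P[->|/vs //].
  by apply: big1 => i _; rewrite (eqP (f0 i)) mulr0.
rewrite negb_forall => /existsP[i0 fi0].
have [v [k vk] vs] := IHs m (fun k j =>
  f (lift i0 k) j * f i0 j0 - f i0 j * f (lift i0 k) j0) lt_sm.
pose w i := if unlift i0 i is Some k then v k * f i0 j0
  else - \sum_k v k * f (lift i0 k) j0.
exists w; first by exists (lift i0 k); rewrite /w liftK mulf_neq0.
have wE j : \sum_i w i * f i j = \sum_k v k *
    (f (lift i0 k) j * f i0 j0 - f i0 j * f (lift i0 k) j0).
  rewrite (bigD1_ord i0) //= {1}/w unlift_none mulNr mulr_suml addrC.
  rewrite -sumrB; apply: eq_bigr => i _.
  by rewrite /w liftK mulrBr -!mulrA; congr (_ * _ - _ * _); rewrite mulrC.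
move=> j; rewrite inE wE => /predU1P[->|/vs //].
by apply: big1 => i _; rewrite mulrC [X in X - _]mulrC subrr mul0r.
Qed.

Section DiagonalMahler.
Variables (F : fieldType) (Q : nat) (I : finType) (a : I -> {poly {poly F}}).
Hypothesis Q_gt1 : (1 < Q)%N.

(** The inner variable is [x], the outer one [z]; [cocycle i s] is the [phi i s] of the introduction
    and [cocycle_val i n] its [v i n]. *)
Definition cocycle i s : {poly {poly F}} := \prod_(b < s) (a i \Po 'X^(Q ^ b)).
Definition cocycle_val i n : {poly F} := (cocycle i n).['X].

Lemma cocycle_valD i n s : cocycle_val i (n + s)
  = cocycle_val i n * (cocycle i s).['X^(Q ^ n)].
Proof.
rewrite /cocycle_val /cocycle big_split_ord /= hornerM; congr (_ * _).
rewrite !horner_prod; apply: eq_bigr => b _.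
by rewrite !horner_comp !hornerXn -exprM expnD.
Qed.

Lemma cocycle_valS i n :
  cocycle_val i n.+1 = cocycle_val i n * (a i).['X^(Q ^ n)].
Proof.
rewrite -addn1 cocycle_valD /cocycle big_ord1 horner_comp hornerXn.
by rewrite expn0 expr1.
Qed.

Hypothesis a_val_neq0 : forall i n, (a i).['X^(Q ^ n)] != 0.
Hypothesis a0_neq0 : forall i, (a i).[0] != 0.
(* For every [i != j], no quotient [h = R1 / R0] of nonzero polynomials solves
   [h (z ^ Q ^ s) / h z = cocycle i s / cocycle j s] for all [s]. *)
Hypothesis a_indep : forall i j (R0 R1 : {poly {poly F}}), i != j ->
  R0 != 0 -> R1 != 0 -> exists s,
    R0 * (R1 \Po 'X^(Q ^ s)) * cocycle j s
      != (R0 \Po 'X^(Q ^ s)) * R1 * cocycle i s.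

Lemma cocycle_val_neq0 i n : cocycle_val i n != 0.
Proof.
elim: n => [|n IHn]; last by rewrite cocycle_valS mulf_neq0.
by rewrite /cocycle_val /cocycle big_ord0 hornerC oner_neq0.
Qed.

Lemma cocycle0_neq0 i s : (cocycle i s).[0] != 0.
Proof.
rewrite horner_prod; apply/prodf_neq0 => b _.
by rewrite horner_comp hornerXn expr0n expn_eq0 gtn_eqF // (ltnW Q_gt1).
Qed.

Lemma expnQ_inj : injective (fun k => 'X^(Q ^ k) : {poly F}).
Proof.
move=> k k' /(congr1 (fun p : {poly F} => size p)).
by rewrite !size_polyXn => -[] /(expnI Q_gt1).
Qed.

(* A shortest counterexample, shifted by [s] and recombined with itself so as to
   lose a term, yields the functional equation excluded by [a_indep]. *)
Lemma cocycle_sum_neq0 k0 (R : I -> {poly {poly F}}) :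
  (forall k, (k0 <= k)%N ->
    \sum_i (R i).['X^(Q ^ k)] * cocycle_val i k = 0) ->
  forall i, R i = 0.
Proof.
have [n] := ubnP #|[set i | R i != 0]|; elim: n R => // n IHn R.
rewrite ltnS => cardR ER i; apply/eqP; apply: contraT => Ri0.
have [j /andP[neq_ji Rj0]|noj] := pickP (fun j => (j != i) && (R j != 0)).
  have [s /negP[]] := a_indep neq_ji Rj0 Ri0.
  (* The [j] term is eliminated between the relations at [k] and [k + s]; the induction hypothesis
     then gives [R' i = 0], the equality that [a_indep] rules out. *)
  pose R' m := R j * (R m \Po 'X^(Q ^ s)) * cocycle m s
    - (R j \Po 'X^(Q ^ s)) * R m * cocycle j s.
  rewrite -subr_eq0; apply/eqP; apply: (IHn R'); last first.
    move=> k le_k; have := ER (k + s)%N (leq_trans le_k (leq_addr _ _)).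
    have comp_val (P : {poly {poly F}}) :
        (P \Po 'X^(Q ^ s)).['X^(Q ^ k)] = P.['X^(Q ^ (k + s))].
      by rewrite horner_comp hornerXn -exprM expnD.
    move=> Eks; transitivity ((R j).['X^(Q ^ k)]
          * (\sum_m (R m).['X^(Q ^ (k + s))] * cocycle_val m (k + s))
        - (R j).['X^(Q ^ (k + s))] * (cocycle j s).['X^(Q ^ k)]
          * \sum_m (R m).['X^(Q ^ k)] * cocycle_val m k).
      rewrite !mulr_sumr -sumrB; apply: eq_bigr => m _.
      rewrite /R' hornerD hornerN !hornerM !comp_val cocycle_valD mulrBl.
      congr (_ - _); first by rewrite -!mulrA; do 2!congr (_ * _); rewrite mulrC.
      by rewrite -!mulrA; congr (_ * _); rewrite mulrCA.
    by rewrite Eks ER // !mulr0 subrr.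
  apply: leq_trans cardR; apply: proper_card; apply/properP; split.
    apply/fintype.subsetP => m; rewrite !inE; apply: contraNneq => Rm0.
    by rewrite /R' Rm0 comp_poly0 !(mulr0, mul0r) subrr.
  exists j; rewrite !inE ?Rj0 // negbK; apply/eqP.
  by rewrite /R' [R j * _]mulrC subrr.
have [k1 Rk1] := horner_neq0_large expnQ_inj Ri0.
have /eqP := ER (maxn k0 k1) (leq_maxl _ _).
rewrite (bigD1 i) //= big1 ?addr0 => [|m neq_mi].
  by rewrite mulf_eq0 (negbTE (Rk1 _ (leq_maxr _ _))) (negbTE (cocycle_val_neq0 _ _)).
have := noj m; rewrite neq_mi => /negbFE/eqP ->.
by rewrite horner0 mul0r.
Qed.

(** [B] absorbs the degrees in [x] of the coefficients, so that only the degree in [z] governs the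
    growth in [t]. *)
Lemma size_horner_Xn d (R : {poly {poly F}}) : (size R <= d.+1)%N ->
  exists B, forall t, (size R.['X^t] <= B + d * t)%N.
Proof.
move=> sizeR; exists (\sum_(i < size R) size (R`_i)%R)%N => t.
rewrite horner_coef; apply: leq_trans (size_sum _ _ _) _.
apply/bigmax_leqP => i _; rewrite -exprM mulnC.
apply: leq_trans (size_polyMleq _ _) _; rewrite size_polyXn addnS /=.
apply: leq_add; last first.
    by rewrite leq_mul2r -ltnS (leq_trans (ltn_ord i) sizeR) orbT.
by rewrite (bigD1 i) //= leq_addr.
Qed.

(** The factors grow like [Q ^ n], and since [2 <= Q] one constant [C] survives each step:
    [C * Q ^ n + C * Q ^ n <= C * Q ^ n.+1]. *)
Lemma size_cocycle_val : exists2 C, (0 < C)%N &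
  forall i n, (size (cocycle_val i n) <= C * Q ^ n)%N.
Proof.
have bound i : exists C, forall n, (size (a i).['X^(Q ^ n)] <= C * Q ^ n)%N.
  have [B Ba] := size_horner_Xn (leqnSn (size (a i))).
  exists (B + size (a i))%N => n; apply: leq_trans (Ba _) _.
  by rewrite mulnDl leq_add2r leq_pmulr // expn_gt0 (ltnW Q_gt1).
pose C i := xget 0%N [set C | forall n, (size (a i).['X^(Q ^ n)] <= C * Q ^ n)%N].
have CP i n : (size (a i).['X^(Q ^ n)] <= C i * Q ^ n)%N.
  by rewrite /C; case: xgetP => [x _ /(_ n)//|no]; have [x /no] := bound i.
exists (\sum_i C i).+1%N => // i; elim=> [|n IHn].
  by rewrite /cocycle_val /cocycle big_ord0 hornerC size_polyC oner_neq0 muln1.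
rewrite cocycle_valS; apply: leq_trans (size_polyMleq _ _) _.
apply: leq_trans (leq_pred _) _.
apply: (@leq_trans ((\sum_i C i).+1 * Q ^ n + (\sum_i C i).+1 * Q ^ n)%N).
  apply: leq_add IHn (leq_trans (CP i n) _).
  by rewrite leq_mul2r (bigD1 i) //= leqW ?leq_addr ?orbT.
by rewrite addnn -muln2 -mulnA leq_mul2l expnS mulnC leq_mul2r Q_gt1 !orbT.
Qed.

(* Simultaneous Pade approximation of the [c i * cocycle i K]. *)
Lemma pade_approximants (c : I -> {poly F}) K N C d :
  (#|I| * C < N)%N -> (N <= d + C)%N ->
  exists2 g : {poly {poly F}}, g != 0 & (size g <= N)%N /\
    forall i, (size (take_poly N ((c i)%:P * g * cocycle i K)) <= d)%N.
Proof.
move=> ltN le_NdC.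
(* The unknowns are the [N] coefficients of [g]; the [#|I| * C] equations kill the coefficients of
   index [d] to [d + C - 1], hence all those from [d] up to [N]. *)
have [] := @homogeneous_system {poly F} (I * 'I_C)%type (enum {: I * 'I_C}) N
  (fun h ie => ('X^h * ((c ie.1)%:P * cocycle ie.1 K))`_(d + ie.2)).
  by rewrite -cardE card_prod card_ord.
move=> v [h0 vh0] vs; pose g := \sum_(h < N) v h *: 'X^h : {poly {poly F}}.
have gE h : g`_h = if insub h is Some k then v k else 0.
  rewrite coef_sum; case: insubP => [k _ <-|le_Nh].
    rewrite (bigD1 k) //= coefZ coefXn eqxx mulr1 big1 ?addr0 // => m neq_mk.
    by rewrite coefZ coefXn eq_sym (inj_eq val_inj) (negbTE neq_mk) mulr0.
  apply: big1 => m _; rewrite coefZ coefXn.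
  by rewrite gtn_eqF ?mulr0 // (leq_trans (ltn_ord m)) // leqNgt.
exists g.
  apply/eqP => g0; have := gE h0; rewrite g0 coef0 valK => /esym/eqP.
  by rewrite (negbTE vh0).
split; first by apply/leq_sizeP => h le_Nh; rewrite gE insubF // ltnNge le_Nh.
move=> i; apply/leq_sizeP => h le_dh; rewrite coef_take_poly; case: ifP => // lt_hN.
have lt_hC : (h - d < C)%N by rewrite ltn_subLR // (leq_trans lt_hN).
have := vs (i, Ordinal lt_hC); rewrite mem_enum => /(_ isT) /=; rewrite subnKC // => vs_h.
apply: etrans vs_h; rewrite mulrAC mulrC /g mulr_suml coef_sum.
by apply: eq_bigr => k _; rewrite -scalerAl coefZ.
Qed.

Theorem diagonal_mahler (c : I -> {poly F}) :
  (forall n, 'X^(Q ^ n) %| \sum_i c i * cocycle_val i n) -> forall i, c i = 0.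
Proof.
move=> c_dvd i0; apply/eqP; apply: contraT => ci0.
have [C C_gt0 sizeC] := size_cocycle_val.
(* [N] exceeds the number of equations [#|I| * C], and [d.+1 + C = N] leaves a margin of one [Q ^ k]
   in the final degree comparison. *)
pose N := (#|I| * C).+1; pose d := (N - C).-1.
have I_gt0 : (0 < #|I|)%N by apply/card_gt0P; exists i0.
have lt_CN : (C < N)%N by rewrite ltnS leq_pmull.
have dE : (d.+1 + C)%N = N by rewrite /d prednK ?subn_gt0 // subnK // ltnW.
have [g g0 [sizeg sizeR]] := @pade_approximants c N N C d.+1 (ltnSn _) (eq_leq (esym dE)).
pose P i := (c i)%:P * g * cocycle i N.
pose R i := take_poly N (P i).
(* The lowest nonzero coefficient of [g], of index below [N], gets multiplied by [c i0] and by the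
   nonzero constant term of the cocycle. *)
have R0 : R i0 != 0.
  have [m gm minm] : exists2 m, g`_m != 0 & forall h, (h < m)%N -> g`_h = 0.
    have ex : exists m, g`_m != 0.
      by exists (size g).-1; rewrite -lead_coefE lead_coef_eq0.
    case: (ex_minnP ex) => m gm minm; exists m => // h lt_hm; apply/eqP.
    by apply: contraTT lt_hm => /minm; rewrite -leqNgt.
  apply/eqP => /(congr1 (fun p : {poly {poly F}} => p`_m)) /eqP.
  rewrite coef0 coef_take_poly ifT; last first.
    by apply: leq_trans sizeg; rewrite ltnNge; apply: contra gm => /(nth_default 0) ->.
  rewrite /P -mulrA coefCM coefM big_ord_recr /= subnn big1 ?add0r.
    by rewrite !mulf_eq0 (negbTE ci0) (negbTE gm) -horner_coef0 (negbTE (cocycle0_neq0 _ _)).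
  by move=> h _; rewrite minm ?mul0r.
(* As the approximants are taken with [K = N], divisibility by ['X^(Q ^ (k + N))] implies
   divisibility by ['X^(N * Q ^ k)]. *)
have le_QN : (N <= Q ^ N)%N by apply: ltnW; apply: ltn_expl.
pose E k := \sum_i (R i).['X^(Q ^ k)] * cocycle_val i k.
have E_dvd k : 'X^(N * Q ^ k) %| E k.
  have -> : E k = g.['X^(Q ^ k)] * (\sum_i c i * cocycle_val i (k + N))
      - 'X^(N * Q ^ k) * \sum_i (drop_poly N (P i)).['X^(Q ^ k)] * cocycle_val i k.
    rewrite /E !mulr_sumr -sumrB; apply: eq_bigr => i _.
    have -> : R i = P i - drop_poly N (P i) * 'X^N.
      by rewrite -[X in X - _](poly_take_drop N) addrK.
    rewrite hornerD hornerN !hornerM hornerXn hornerC mulrBl -exprM.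
    rewrite [(Q ^ k * N)%N]mulnC cocycle_valD.
    congr (_ - _); last by rewrite [X in X * _]mulrC -!mulrA.
    by rewrite -!mulrA mulrCA; congr (_ * (_ * _)); rewrite mulrC.
  apply: dvdp_sub; last exact: dvdp_mulIl.
  apply: dvdp_mull; apply: dvdp_trans (c_dvd (k + N)%N).
  by rewrite dvdp_exp2l // expnD mulnC leq_mul2l le_QN orbT.
have Rbound i : exists B, forall t, (size (R i).['X^t] <= B + d * t)%N.
  exact: size_horner_Xn (sizeR i).
pose B i := xget 0%N [set B | forall t, (size (R i).['X^t] <= B + d * t)%N].
have BP i t : (size (R i).['X^t] <= B i + d * t)%N.
  by rewrite /B; case: xgetP => [x _ /(_ t)//|no]; have [x /no] := Rbound i.
have sizeE k : (size (E k) <= \sum_i B i + d * Q ^ k + C * Q ^ k)%N.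
  apply: leq_trans (size_sum _ _ _) _; apply/bigmax_leqP => i _.
  apply: leq_trans (size_polyMleq _ _) _; apply: leq_trans (leq_pred _) _.
  apply: leq_add (sizeC i k); apply: leq_trans (BP i _) _.
  by rewrite leq_add2r (bigD1 i) //= leq_addr.
suff E0 k : (\sum_i B i <= k)%N -> E k = 0.
  by have := cocycle_sum_neq0 E0 i0; move/eqP; rewrite (negbTE R0).
(* For such [k], a nonzero [E k] would force [Q ^ k < \sum_i B i <= k]. *)
move=> le_Bk; apply/eqP; apply: contraT => Ek0.
have := dvdp_leq Ek0 (E_dvd k); rewrite size_polyXn => /leq_trans/(_ (sizeE k)).
rewrite -dE !mulnDl mulSn -!addnA ltn_add2r => /leq_trans/(_ le_Bk).
by rewrite ltnNge ltnW // ltn_expl.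
Qed.

End DiagonalMahler.

(** * The system of the partial products *)

Section Specialization.
Variables (F : fieldType) (n : nat).

(* Substitutes [z ^ n] for the inner variable [x] and keeps the outer one, [z]. *)
Definition specialize : {rmorphism {poly {poly F}} -> {poly F}} :=
  horner_eval 'X \o map_poly (comp_poly 'X^n).

Lemma specialize_Xn m : specialize 'X^m = 'X^m.
Proof. by rewrite rmorphXn /= map_polyX /horner_eval hornerX. Qed.

Lemma specializeC p : specialize p%:P = p \Po 'X^n.
Proof. by rewrite /= map_polyC /horner_eval hornerC. Qed.

Lemma specialize_comp R t :
  specialize (R \Po 'X^(n * t)) = R.['X^t] \Po 'X^n.
Proof.
rewrite /= /horner_eval map_comp_poly horner_comp map_polyXn hornerXn.
by rewrite -horner_map /= rmorphXn /= comp_polyX exprM.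
Qed.

Lemma specialize_swapXY R : specialize R = (swapXY R).['X^n].
Proof.
elim/poly_ind: R => [|R c IHR]; first by rewrite !rmorph0 horner0.
rewrite !rmorphD !rmorphM hornerD hornerM IHR [in RHS]/=.
by rewrite (specialize_Xn 1 : specialize 'X = 'X) specializeC swapXY_X swapXY_polyC hornerC.
Qed.
End Specialization.

Lemma polyXn_inj (F : fieldType) : injective (fun n => 'X^n : {poly F}).
Proof.
by move=> m n /(congr1 (fun p : {poly F} => size p)); rewrite !size_polyXn => -[].
Qed.

Section GammaCocycle.
Variables (F : fieldType) (q l D : nat) (I : finType) (mu : I -> 'I_l -> nat).
Hypotheses (q_gt1 : (1 < q)%N) (l_gt0 : (0 < l)%N).
Hypothesis mu_le : forall i, (\sum_j mu i j <= D)%N.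

(** At [z = x ^ Q ^ n] each [x - z ^ q ^ j.+1] is [x] times [1 - x ^ (q ^ (j.+1 + l * n) - 1)]; the
    leading power of [x] brings the surplus to [x ^ D], the same for all [i]. *)
Definition gamma_factor i : {poly {poly F}} :=
  ('X^(D - \sum_j mu i j))%:P * \prod_(j < l) ('X%:P - 'X^(q ^ j.+1)) ^+ mu i j.

Let Q := (q ^ l)%N.

Let Q_gt1 : (1 < Q)%N.
Proof. by rewrite -(exp1n l) ltn_exp2r. Qed.

Lemma gamma_factor_comp i b : gamma_factor i \Po 'X^(Q ^ b)
  = ('X^(D - \sum_j mu i j))%:P
    * \prod_(j < l) ('X%:P - 'X^(q ^ (j.+1 + l * b))) ^+ mu i j.
Proof.
rewrite /gamma_factor comp_polyM comp_polyC rmorph_prod; congr (_ * _).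
apply: eq_bigr => j _ /=; rewrite rmorphXn /= rmorphB /= comp_polyC comp_Xn_poly.
by rewrite -exprM -expnM -expnD addnC.
Qed.

Lemma gamma_factor_val i n : (gamma_factor i).['X^(Q ^ n)] = 'X^D
  * \prod_(j < l) (1 - 'X^(q ^ (j.+1 + l * n) - 1)) ^+ mu i j.
Proof.
rewrite /gamma_factor hornerM hornerC -[in RHS](subnK (mu_le i)) exprD -mulrA.
congr (_ * _); rewrite expr_sum -big_split horner_prod; apply: eq_bigr => j _ /=.
rewrite horner_exp hornerD hornerN hornerC hornerXn -exprMn; congr (_ ^+ _).
rewrite mulrBr mulr1 -exprS -exprM -expnM -expnD addnC subn1 prednK //.
by rewrite expn_gt0 ltnW.
Qed.

Lemma gamma_cocycle_val i n : cocycle_val Q gamma_factor i n = 'X^(n * D)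
  * \prod_(j < l) (\prod_(b < n) (1 - 'X^(q ^ (j.+1 + l * b) - 1))) ^+ mu i j.
Proof.
elim: n => [|n IHn].
  rewrite /cocycle_val /cocycle big_ord0 hornerC mul0n mul1r big1 // => j _.
  by rewrite big_ord0 expr1n.
rewrite cocycle_valS IHn gamma_factor_val mulSnr exprD mulrACA; congr (_ * _).
by rewrite -big_split; apply: eq_bigr => j _; rewrite big_ord_recr exprMn.
Qed.

Lemma gamma_exponent_inj (j j' : 'I_l) b b' :
  (q ^ (j.+1 + l * b))%N = (q ^ (j'.+1 + l * b'))%N -> j = j' /\ b = b'.
Proof.
move=> /(expnI q_gt1); rewrite !addSn => -[]; rewrite ![(_ + l * _)%N]addnC => eq_jb.
have eq_b : b = b'.
  have := congr1 (divn^~ l) eq_jb.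
  by rewrite /= ![(l * _)%N]mulnC !divnMDl // !divn_small // !addn0.
by split=> //; apply/val_inj/eqP; rewrite -(eqn_add2l (l * b)) {2}eq_b eq_jb.
Qed.

Lemma specialize_factor_neq0 m n : m != n ->
  specialize F n ('X%:P - 'X^m) != 0.
Proof.
move=> neq_mn; rewrite rmorphB specialize_Xn specializeC comp_polyX subr_eq0.
by rewrite (inj_eq (@polyXn_inj F)) eq_sym.
Qed.

(** Along [x = z ^ n] with [n = q ^ (j.+1 + l * b)] only the factor shown vanishes, because distinct
    pairs [j], [b] give distinct exponents. Thus [mu i j] is the exact multiplicity. *)
Lemma gamma_cocycle_split i (j : 'I_l) b s : (b < s)%N ->
  exists2 rho, specialize F (q ^ (j.+1 + l * b)) rho != 0
    & cocycle Q gamma_factor i s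
      = ('X%:P - 'X^(q ^ (j.+1 + l * b))) ^+ mu i j * rho.
Proof.
move=> lt_bs; set n := (q ^ _)%N.
pose C : {poly F} := 'X^(D - \sum_j mu i j).
have C0 : specialize F n C%:P != 0.
  by rewrite specializeC comp_Xn_poly expf_neq0 // (monic_neq0 (monicXn _ _)).
exists (C%:P * \prod_(j' < l | j' != j)
    ('X%:P - 'X^(q ^ (j'.+1 + l * b))) ^+ mu i j'
  * \prod_(b' < s | b' != Ordinal lt_bs) (gamma_factor i \Po 'X^(Q ^ b'))); last first.
  rewrite /cocycle (bigD1 (Ordinal lt_bs)) //= gamma_factor_comp -/C.
  by rewrite (bigD1 j) //= mulrCA -!mulrA.
rewrite !rmorphM !mulf_neq0 //.
  rewrite rmorph_prod; apply/prodf_neq0 => j' neq_j'.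
  rewrite rmorphXn expf_neq0 // specialize_factor_neq0 //.
  by apply: contraNneq neq_j' => /gamma_exponent_inj[->].
rewrite rmorph_prod; apply/prodf_neq0 => b' neq_b'.
rewrite gamma_factor_comp rmorphM mulf_neq0 // rmorph_prod.
apply/prodf_neq0 => j' _; rewrite rmorphXn expf_neq0 // specialize_factor_neq0 //.
by apply: contraNneq neq_b' => /gamma_exponent_inj[_ eq_b]; apply/eqP/val_inj.
Qed.

(** The two sides differ in their multiplicity along [x = z ^ n]: it is at least [mu i' j] on the
    left, and exactly [mu i j] on the right once [n] and [s] are such that [R0] and [R1] do not
    contribute there. *)
Lemma gamma_functional_equation i i' (j : 'I_l) (R0 R1 : {poly {poly F}}) :
  (mu i j < mu i' j)%N -> R0 != 0 -> R1 != 0 -> exists s,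
    R0 * (R1 \Po 'X^(Q ^ s)) * cocycle Q gamma_factor i' s
      != (R0 \Po 'X^(Q ^ s)) * R1 * cocycle Q gamma_factor i s.
Proof.
move=> lt_mu R0n0 R1n0.
have [t0 R0t] := horner_neq0_large (@polyXn_inj F) R0n0.
have swapR1 : swapXY R1 != 0 by rewrite swapXY_eq0.
have [b0 R1b] := horner_neq0_large (@polyXn_inj F) swapR1.
(* [n >= b0] keeps [R1] from vanishing along [x = z ^ n]; the [s] below makes [Q ^ s] equal to [n]
   times a number at least [t0], which does the same for [R0 \Po 'X^(Q ^ s)]. *)
pose b := b0; pose n := (q ^ (j.+1 + l * b))%N.
pose s := (b + t0).+1.
have lt_bs : (b < s)%N by rewrite ltnS leq_addr.
exists s; have [rho rho0 ->] := gamma_cocycle_split i j lt_bs.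
have [rho' _ ->] := gamma_cocycle_split i' j lt_bs.
rewrite -/n; set pi := 'X%:P - 'X^n.
have pi0 : specialize F n pi = 0.
  by rewrite rmorphB specialize_Xn specializeC comp_polyX subrr.
have pin0 : pi != 0.
  have : specialize F n.+1 pi != 0 by rewrite specialize_factor_neq0 // ltn_eqF.
  by apply: contraNneq => ->; rewrite rmorph0.
apply/eqP => eqR.
have /(mulfI (expf_neq0 _ pin0)) : pi ^+ mu i j * (R0 * (R1 \Po 'X^(Q ^ s))
      * (pi ^+ (mu i' j - mu i j) * rho'))
    = pi ^+ mu i j * ((R0 \Po 'X^(Q ^ s)) * R1 * rho).
  rewrite [RHS]mulrCA -eqR [LHS]mulrCA [pi ^+ mu i j * _]mulrA -exprD.
  by rewrite subnKC // ltnW.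
move/(congr1 (specialize F n)); rewrite !rmorphM rmorphXn pi0.
have -> : (0 : {poly F}) ^+ (mu i' j - mu i j) = 0.
  by rewrite expr0n subn_eq0 leqNgt lt_mu.
rewrite mul0r mulr0 => /esym/eqP; apply/negP.
have le_b0n : (b0 <= n)%N.
  apply: leq_trans (ltnW (ltn_expl _ q_gt1)).
  by rewrite (leq_trans _ (leq_addl _ _)) // leq_pmull.
rewrite !mulf_neq0 //; last by rewrite specialize_swapXY R1b.
have -> : (Q ^ s = n * q ^ (l * t0 + (l - j.+1)))%N.
  rewrite -expnM -expnD; congr (_ ^ _)%N.
  rewrite addnCA [in RHS]addnAC subnKC ?ltn_ord // /s.
  by rewrite addnC -mulnS -mulnDr addnS.
rewrite (specialize_comp n R0) comp_poly_eq0; last first.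
  by rewrite size_polyXn ltnS expn_gt0 ltnW.
rewrite R0t //; apply: leq_trans (ltnW (ltn_expl _ q_gt1)).
by rewrite (leq_trans _ (leq_addr _ _)) // leq_pmull.
Qed.

Hypothesis mu_inj : forall i i', i != i' -> exists j, mu i j != mu i' j.

Theorem gamma_mahler (c : I -> {poly F}) :
  (forall n, 'X^(Q ^ n) %| \sum_i c i * \prod_(j < l)
     (\prod_(b < n) (1 - 'X^(q ^ (j.+1 + l * b) - 1))) ^+ mu i j) ->
  forall i, c i = 0.
Proof.
move=> c_dvd; apply: (@diagonal_mahler F Q I gamma_factor Q_gt1).
- move=> i n; rewrite gamma_factor_val mulf_neq0 ?(monic_neq0 (monicXn _ _)) //.
  apply/prodf_neq0 => j _; rewrite expf_neq0 // subr_eq0 -(expr0 'X).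
  rewrite (inj_eq (@polyXn_inj F)) eq_sym subn_eq0 -ltnNge.
  by rewrite -(expn0 q) ltn_exp2l.
- move=> i; rewrite /gamma_factor hornerM hornerC.
  rewrite mulf_neq0 ?(monic_neq0 (monicXn _ _)) //.
  rewrite horner_prod; apply/prodf_neq0 => j _.
  rewrite horner_exp hornerD hornerN hornerC hornerXn expr0n expn_eq0.
  by rewrite gtn_eqF ?(ltnW q_gt1) // subr0 expf_neq0 // polyX_eq0.
- move=> i i' R0 R1 /mu_inj[j]; rewrite neq_ltn => /orP[lt_mu|lt_mu] R0n0 R1n0.
    exact: gamma_functional_equation lt_mu R0n0 R1n0.
  have [s neqs] := gamma_functional_equation lt_mu R1n0 R0n0.
  by exists s; rewrite eq_sym [X in X * _]mulrC [X in _ != X * _]mulrC.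
(* The values carry a common factor ['X^(n * D)], which preserves the divisibility. *)
- move=> n; under eq_bigr => i _ do rewrite gamma_cocycle_val mulrCA.
  by rewrite -mulr_sumr dvdp_mull.
Qed.

End GammaCocycle.

Local Open Scope classical_set_scope.

(** * Algebraic dependence *)

Section AlgebraicClosure.
Variable E : fieldType.
Implicit Types A B K : set E.

Lemma field_gen_divring A : GRing.divring_closed (mem (field_gen A)).
Proof.
split=> [|x y|x y]; rewrite !inE.
- by move=> K [[K1 _ _] _]; have := K1; rewrite inE.
- move=> Ax Ay K KA; have [[_ KB _] _] := KA.
  by have := KB x y; rewrite !inE; apply; [exact: Ax|exact: Ay].
- move=> Ax Ay K KA; have [[_ _ KD] _] := KA.
  by have := KD x y; rewrite !inE; apply; [exact: Ax|exact: Ay].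
Qed.

Definition field_gen_pred A : {pred E} := mem (field_gen A).
HB.instance Definition _ A :=
  GRing.isDivringClosed.Build E (field_gen_pred A) (field_gen_divring A).

(** The generated subfield as a field type, over which the closure properties of [integralOver]
    apply. *)
Definition gen_field A := {x : E | x \in field_gen_pred A}.
HB.instance Definition _ A := SubChoice.on (gen_field A).
HB.instance Definition _ A :=
  [SubChoice_isSubIntegralDomain of gen_field A by <:].
HB.instance Definition _ A := [SubIntegralDomain_isSubField of gen_field A by <:].


Lemma sub_field_gen A : A `<=` field_gen A.
Proof. exact: sub_gen_smallest. Qed.

Lemma field_gen_sub A K :
  GRing.divring_closed (mem K) -> A `<=` K -> field_gen A `<=` K.
Proof. exact: smallest_sub. Qed.

Lemma algebraic_overE A x : algebraic_over (field_gen A) x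
  <-> integralOver (val : gen_field A -> E) x.
Proof.
split=> [[P [P0 PA Px]]|/integral_algebraic[P P0 Px]].
  apply: integral_root P0 Px _ => y /(allP PA) yA.
  by rewrite -[y]/(val (exist _ y yA : gen_field A)); apply: integral_id.
exists (map_poly val P); split=> //; first by rewrite map_poly_eq0.
by apply/allP => _ /(nthP 0)[i _ <-]; rewrite coef_map; apply: (valP P`_i).
Qed.

Definition alg_closure A : {pred E} :=
  fun x => `[< algebraic_over (field_gen A) x >].

Lemma alg_closureP A x :
  reflect (integralOver (val : gen_field A -> E) x) (x \in alg_closure A).
Proof.
by apply: (iffP (asboolP _)) => Ax; apply/algebraic_overE.
Qed.

Lemma alg_closure_divring A : GRing.divring_closed (alg_closure A).
Proof.
split=> [|x y /alg_closureP Ax /alg_closureP Ay|x y /alg_closureP Ax /alg_closureP Ay].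
- by apply/alg_closureP; apply: integral1.
- by apply/alg_closureP; apply: integral_sub.
- by apply/alg_closureP; apply: integral_div.
Qed.
HB.instance Definition _ A :=
  GRing.isDivringClosed.Build E (alg_closure A) (alg_closure_divring A).

Lemma sub_alg_closure A x : A x -> x \in alg_closure A.
Proof.
move=> Ax; have xA : x \in field_gen_pred A by rewrite inE; apply: sub_field_gen.
by apply/alg_closureP; rewrite -[x]/(val (exist _ x xA : gen_field A)); apply: integral_id.
Qed.

Lemma alg_closure_root A (P : {poly E}) x :
  P != 0 -> P \is a polyOver (alg_closure A) -> root P x -> x \in alg_closure A.
Proof.
move=> P0 PA Px; apply/alg_closureP; apply: integral_root P0 Px _.
by move=> _ /(nthP 0)[i _ <-]; apply/alg_closureP/(polyOverP PA).
Qed.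

Lemma algebraic_over_alg_closure A K x :
  K `<=` [set x | x \in alg_closure A] -> algebraic_over K x ->
  x \in alg_closure A.
Proof.
move=> KA [P [P0 PK Px]]; apply: alg_closure_root P0 _ Px.
by apply/allP => y /(allP PK); rewrite inE => /KA.
Qed.

End AlgebraicClosure.

Local Notation widen := (widen_ord (leqnSn _)).

Section AlgebraicDependence.
Variable E : fieldType.

Lemma mcoeff_muni (R : nzRingType) n (P : {mpoly R[n.+1]}) e m :
  ((muni P)`_e)@_m = \sum_(m' <- msupp P)
    P@_m' * (((m' ord_max == e) && ([multinom m' (widen i) | i < n] == m))%:R).
Proof.
rewrite muniE coef_sum raddf_sum /=; apply: eq_bigr => m' _.
rewrite coefZ coefXn mulr_natr eq_sym.
case: eqP => _ /=; last by rewrite mulr0n mcoeff0 mulr0.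
by rewrite mulr1n mcoeffZ mcoeffX.
Qed.

Lemma muni_inj (R : nzRingType) n (P : {mpoly R[n.+1]}) : muni P = 0 -> P = 0.
Proof.
move=> P0; apply/mpolyP => m; rewrite mcoeff0; apply/eqP; apply: contraT => Pm.
have := mcoeff_muni P (m ord_max) [multinom m (widen i) | i < n].
rewrite P0 coef0 mcoeff0 (bigD1_seq m) ?msupp_uniq ?mcoeff_msupp //= !eqxx mulr1.
rewrite big1 ?addr0 => [/esym/eqP|m' neq_m']; first by rewrite (negbTE Pm).
rewrite [_ && _](_ : _ = false) ?mulr0 //; apply/negP => /andP[/eqP eq_max /eqP eq_w].
case/eqP: neq_m'; apply/mnmP => i; case: (unliftP ord_max i) => [j ->|-> //].
have -> : lift ord_max j = widen j by apply/val_inj; apply: lift_max.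
by have := congr1 (fun u : 'X_{1..n} => u j) eq_w; rewrite !mnmE.
Qed.

Lemma meval_muni n (P : {mpoly E[n.+1]}) (b : 'I_n.+1 -> E) :
  (map_poly (meval (b \o widen)) (muni P)).[b ord_max] = P.@[b].
Proof.
rewrite muniE mevalE raddf_sum horner_sum; apply: eq_bigr => m _ /=.
rewrite map_polyZ map_polyXn hornerZ hornerXn /= mevalZ mevalX big_ord_recr /= -mulrA.
by congr (_ * (_ * _)); apply: eq_bigr => i _; rewrite mnmE.
Qed.

Lemma alg_dependent n (P : {mpoly E[n]}) (b : 'I_n -> E) :
  P != 0 -> P.@[b] = 0 -> exists i, forall A : set E,
    (forall m, P@_m \in alg_closure A) ->
    (forall j, j != i -> b j \in alg_closure A) -> b i \in alg_closure A.
Proof.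
elim: n P b => [|n IHn] P b P0.
  move: P0; rewrite [P]nvar0_mpolyC => + /=; rewrite mevalC => P00 /eqP.
  by rewrite -(mpolyC_eq0 0) (negbTE P00).
move=> Pb; pose b' := b \o widen; pose p := map_poly (meval b') (muni P).
have coefP A e m : (forall m, P@_m \in alg_closure A) ->
    ((muni P)`_e)@_m \in alg_closure A.
  move=> PA; rewrite mcoeff_muni rpred_sum // => m' _.
  by rewrite rpredM ?rpred_nat.
have [p0|p0] := eqVneq p 0.
  have [e Pe] : exists e, (muni P)`_e != 0.
    exists (size (muni P)).-1; rewrite -lead_coefE lead_coef_eq0.
    by apply: contra_neq P0; apply: muni_inj.
  have Pe0 : ((muni P)`_e).@[b'] = 0.
    by have := congr1 (fun u : {poly E} => u`_e) p0; rewrite /p coef_map coef0.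
  have [i iP] := IHn _ b' Pe Pe0.
  exists (widen i) => A PA bA; apply: iP => [m|j neq_ji]; first exact: coefP.
  by apply: bA; apply: contraNneq neq_ji => /(congr1 val) eq_ij; apply/eqP/val_inj.
exists ord_max => A PA bA; apply: alg_closure_root p0 _ _; last first.
  by rewrite rootE meval_muni Pb.
apply/polyOverP => e; rewrite coef_map /= mevalE rpred_sum // => m _.
rewrite rpredM ?coefP // rpred_prod // => j _; rewrite rpredX // bA //.
by rewrite -val_eqE /= ltn_eqF.
Qed.

(** An algebraic equation [p] for [u i], cleared of denominators, lifts to a polynomial [T] over [R]
    that vanishes at [u]; then [T = 0], which contradicts [p != 0]. *)
Lemma not_algebraic_of_independent (R : idomainType) (phi : {rmorphism R -> E}) n
    (u : 'I_n -> E) i :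
  (forall P : {mpoly R[n]}, mmap phi u P = 0 -> P = 0) ->
  u i \notin alg_closure (range phi `|` [set u j | j in [set j | j != i]]).
Proof.
move=> u_indep; apply/negP; set A := _ `|` _.
(* All variables are evaluated except ['X_i], which becomes the variable of [{poly E}]. *)
pose ev : {mpoly R[n]} -> {poly E} :=
  mmap (polyC \o phi) (fun j => if j == i then 'X else (u j)%:P).
have ev_val P : (ev P).[u i] = mmap phi u P.
  rewrite /ev /mmap horner_sum; apply: eq_bigr => m _ /=.
  rewrite hornerM hornerC /mmap1 horner_prod; congr (_ * _).
  apply: eq_bigr => j _; rewrite horner_exp.
  by case: eqP => [->|_]; rewrite ?hornerX ?hornerC.
(* The constants in the image of [ev] form a ring containing [range phi] and the other [u j]; its
   field of fractions [K] therefore contains [field_gen A]. *)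
pose S : set E := [set s | exists P, ev P = s%:P].
have SB x y : S x -> S y -> S (x - y).
  by move=> [P Px] [P' Py]; exists (P - P'); rewrite /ev rmorphB /= -/ev Px Py polyCB.
have SM x y : S x -> S y -> S (x * y).
  by move=> [P Px] [P' Py]; exists (P * P'); rewrite /ev rmorphM /= -/ev Px Py polyCM.
have S1 : S 1 by exists 1; rewrite /ev rmorph1.
pose K : set E := [set z | exists x y, [/\ S x, S y, y != 0 & z = x / y]].
have SK x : S x -> K x by move=> Sx; exists x, 1; rewrite oner_neq0 divr1.
have K_divring : GRing.divring_closed (mem K).
  split=> [|x y|x y]; rewrite !inE; first exact: SK.
    move=> [a [b [Sa Sb b0 ->]]] [c [d [Sc Sd d0 ->]]].
    exists (a * d - c * b), (b * d); split; [apply: SB; exact: SM|exact: SM| |].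
      by rewrite mulf_neq0.
    by rewrite -mulNr addf_div // mulNr.
  move=> [a [b [Sa Sb b0 ->]]] [c [d [Sc Sd d0 ->]]].
  have [->|c0] := eqVneq c 0.
    by rewrite mul0r invr0 mulr0; apply: SK; rewrite -(subrr 1); apply: SB.
  exists (a * d), (b * c); split; [exact: SM|exact: SM| |].
    by rewrite mulf_neq0.
  by rewrite invf_div mulf_div.
have AK : field_gen A `<=` K.
  apply: field_gen_sub K_divring _ => x [[r _ <-]|[j neq_ji <-]]; apply: SK.
    by exists r%:MP; rewrite /ev mmapC.
  by exists 'X_j; rewrite /ev mmapX mmap1U (negbTE neq_ji).
case/asboolP => p [p0 pA pu].
have [d [Sd d0 dp]] : exists d, [/\ S d, d != 0 & forall e, S (d * p`_e)].
  have [d [Sd d0 dp]] : exists d, [/\ S d, d != 0 &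
      forall e, (e < size p)%N -> S (d * p`_e)].
    elim: (size p) => [|n' [d [Sd d0 dp]]]; first by exists 1; rewrite oner_neq0.
    have [x [y [Sx Sy y0 pE]]] : K p`_n'.
      have [lt_n'|le_n'] := ltnP n' (size p).
        by apply: AK; have := allP pA _ (mem_nth 0 lt_n'); rewrite inE.
      by rewrite nth_default //; apply: SK; rewrite -(subrr 1); apply: SB.
    exists (d * y); split; [exact: SM|by rewrite mulf_neq0|].
    move=> e; rewrite ltnS leq_eqVlt => /predU1P[->|/dp Se].
      by rewrite pE mulrA mulrAC mulfK //; apply: SM.
    by rewrite mulrAC; apply: SM.
  exists d; split=> // e; have [/dp//|le_e] := ltnP e (size p).
  by rewrite nth_default // mulr0 -(subrr 1); apply: SB.
have [P PE] := choice dp.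
pose T := \sum_(e < size p) P e * 'X_i ^+ e.
have evT : ev T = d *: p.
  rewrite /T /ev rmorph_sum /= -[p in RHS]coefK poly_def scaler_sumr.
  apply: eq_bigr => e _; rewrite rmorphM rmorphXn /= -/ev PE.
  by rewrite /ev mmapX mmap1U eqxx mul_polyC scalerA.
have T0 : T = 0.
  by apply: u_indep; rewrite -ev_val evT hornerZ (rootP pu) mulr0.
by case/eqP: p0; apply: (scalerI d0); rewrite -evT T0 scaler0 /ev raddf0.
Qed.

End AlgebraicDependence.

(** * Power series *)

Section PowerSeries.
Variable K : fieldType.
Implicit Types (f g s : fps K) (p : {poly K}) (a : nat -> fps K).

Lemma fps_coefB f g n : fps_coef (f - g) n = fps_coef f n - fps_coef g n.
Proof. by []. Qed.

Lemma fps_coefM f g n :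
  fps_coef (f * g) n = \sum_(i < n.+1) fps_coef f i * fps_coef g (n - i).
Proof. by []. Qed.

Lemma fps_coefXM f n :
  fps_coef (fpsX K * f) n = if n is m.+1 then fps_coef f m else 0.
Proof.
rewrite fps_coefM; case: n => [|n]; first by rewrite big_ord1 /= mul0r.
rewrite !big_ord_recl /= mul0r add0r mul1r big1 ?addr0 ?subn1 // => i _.
by rewrite mul0r.
Qed.

Lemma fps_coefXnM N f n :
  fps_coef (fpsX K ^+ N * f) n = if (n < N)%N then 0 else fps_coef f (n - N).
Proof.
elim: N n => [|N IHN] n; first by rewrite mul1r subn0.
by rewrite exprS -mulrA fps_coefXM; case: n => [|n] //; rewrite IHN.
Qed.

Definition poly_fps p : fps K := Fps (fun n => p`_n).

Lemma poly_fps_is_zmod_morphism : zmod_morphism poly_fps.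
Proof. by move=> p r; apply/fpsP => n /=; rewrite coefB. Qed.
Lemma poly_fps_is_monoid_morphism : monoid_morphism poly_fps.
Proof.
split=> [|p r]; apply/fpsP => n; first by rewrite /= coef1; case: n.
by rewrite fps_coefM /= coefM.
Qed.
HB.instance Definition _ :=
  GRing.isZmodMorphism.Build {poly K} (fps K) poly_fps poly_fps_is_zmod_morphism.
HB.instance Definition _ :=
  GRing.isMonoidMorphism.Build {poly K} (fps K) poly_fps poly_fps_is_monoid_morphism.

Lemma poly_fpsX : poly_fps 'X = fpsX K.
Proof. by apply/fpsP => n; rewrite /= coefX. Qed.

Definition fps_eqmod N f g : Prop := exists s, f - g = fpsX K ^+ N * s.

Lemma fps_eqmodP N f g :
  fps_eqmod N f g <-> forall n, (n < N)%N -> fps_coef f n = fps_coef g n.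
Proof.
split=> [[s fgE] n lt_nN|fg].
  by apply/eqP; rewrite -subr_eq0 -fps_coefB fgE fps_coefXnM lt_nN.
exists (Fps (fun n => fps_coef (f - g) (n + N))); apply/fpsP => n.
rewrite fps_coefXnM; case: ltnP => [lt_nN|le_Nn] /=; last by rewrite subnK.
by rewrite fg ?subrr.
Qed.

Lemma fps_eqmod_refl N f : fps_eqmod N f f.
Proof. by apply/fps_eqmodP. Qed.

Lemma fps_eqmod_sym N f g : fps_eqmod N f g -> fps_eqmod N g f.
Proof. by move=> /fps_eqmodP fg; apply/fps_eqmodP => n /fg. Qed.

Lemma fps_eqmod_trans N f g h :
  fps_eqmod N f g -> fps_eqmod N g h -> fps_eqmod N f h.
Proof.
move=> /fps_eqmodP fg /fps_eqmodP gh; apply/fps_eqmodP => n lt_nN.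
by rewrite fg ?gh.
Qed.

Lemma fps_eqmodW M N f g : (M <= N)%N -> fps_eqmod N f g -> fps_eqmod M f g.
Proof.
move=> le_MN /fps_eqmodP fg; apply/fps_eqmodP => n lt_nM.
by rewrite fg // (leq_trans lt_nM).
Qed.

Lemma fps_eqmodD N f f' g g' :
  fps_eqmod N f f' -> fps_eqmod N g g' -> fps_eqmod N (f + g) (f' + g').
Proof.
by move=> [s fE] [t gE]; exists (s + t); rewrite opprD addrACA fE gE mulrDr.
Qed.

Lemma fps_eqmodM N f f' g g' :
  fps_eqmod N f f' -> fps_eqmod N g g' -> fps_eqmod N (f * g) (f' * g').
Proof.
move=> [s fE] [t gE]; exists (s * g + f' * t).
by rewrite mulrDr mulrA -fE mulrCA -gE mulrBl mulrBr addrA subrK.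
Qed.

Lemma fps_eqmodX N f f' n : fps_eqmod N f f' -> fps_eqmod N (f ^+ n) (f' ^+ n).
Proof.
move=> ff'; elim: n => [|n IHn]; first exact: fps_eqmod_refl.
by rewrite !exprS; apply: fps_eqmodM.
Qed.

Lemma fps_eqmod_prod N (I : Type) (r : seq I) (P : pred I) (u v : I -> fps K) :
  (forall i, fps_eqmod N (u i) (v i)) ->
  fps_eqmod N (\prod_(i <- r | P i) u i) (\prod_(i <- r | P i) v i).
Proof.
move=> uv; apply: (big_ind2 (fps_eqmod N)) => //; first exact: fps_eqmod_refl.
by move=> f f' g g'; apply: fps_eqmodM.
Qed.

Lemma fps_eqmod_sum N (I : Type) (r : seq I) (P : pred I) (u v : I -> fps K) :
  (forall i, fps_eqmod N (u i) (v i)) ->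
  fps_eqmod N (\sum_(i <- r | P i) u i) (\sum_(i <- r | P i) v i).
Proof.
move=> uv; apply: (big_ind2 (fps_eqmod N)) => //; first exact: fps_eqmod_refl.
by move=> f f' g g'; apply: fps_eqmodD.
Qed.

Lemma fps_eqmod_eq f g : (forall N, fps_eqmod N f g) -> f = g.
Proof. by move=> fg; apply/fpsP => n; have /fps_eqmodP := fg n.+1; apply. Qed.

Lemma poly_fps_eqmod0 N p : fps_eqmod N (poly_fps p) 0 -> 'X^N %| p.
Proof.
move=> /fps_eqmodP p0; rewrite -(poly_take_drop N p).
rewrite (_ : take_poly N p = 0) ?add0r ?dvdp_mulIr //.
by apply/polyP => n; rewrite coef_take_poly coef0; case: ifP => // /p0.
Qed.

(** The diagonal: for a sequence as in [fps_limP], the coefficient of index [n] is stable from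
    [a n.+1] on. *)
Definition fps_lim a : fps K := Fps (fun n => fps_coef (a n.+1) n).

Lemma fps_limP (e : nat -> nat) a :
  {homo e : m n / (m <= n)%N} -> (forall n, (n <= e n)%N) ->
  (forall n, fps_eqmod (e n) (a n.+1) (a n)) ->
  forall n, fps_eqmod (e n) (fps_lim a) (a n).
Proof.
move=> e_homo le_e a_step n; apply/fps_eqmodP => i lt_ie /=.
have a_eqmod m k : (m <= k)%N -> fps_eqmod (e m) (a k) (a m).
  move/subnK <-; elim: (k - m)%N => [|j IHj]; first exact: fps_eqmod_refl.
  apply: fps_eqmod_trans IHj; apply: fps_eqmodW (a_step _).
  by rewrite e_homo // leq_addl.
case: (leqP n i.+1) => [/a_eqmod/fps_eqmodP->//|lt_in].
by have /fps_eqmodP -> := a_eqmod _ _ (ltnW lt_in).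
Qed.

End PowerSeries.

(** * Gamma products *)

Section GammaSeries.
Variables (p e : nat) (F : finFieldType).
Hypotheses (p_prime : prime p) (e_gt0 : (0 < e)%N).
Hypothesis card_F : #|F| = (p ^ e)%N.

Local Notation q := #|F|.

Let q_gt1 : (1 < q)%N.
Proof. by rewrite card_F -(exp1n e) ltn_exp2r // prime_gt1. Qed.

(** This is [Dbar n] in the variable [x]: each factor of [D n] is divided by [theta ^ q ^ n]. *)
Definition dbar n : {poly F} := \prod_(m < n) (1 - 'X^(q ^ n - q ^ m)).

(** The [q]-th power is additive here, so it multiplies the exponents by [q] and turns the factors
    of [dbar n] into those of [dbar n.+1], except the one with [m = 0]. *)
Lemma dbarS n : dbar n.+1 = (1 - 'X^(q ^ n.+1 - 1)) * dbar n ^+ q.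
Proof.
rewrite /dbar big_ord_recl expn0 -prodrXl; congr (_ * _).
apply: eq_bigr => m _; have q_pchar : [pchar {poly F}].-nat q.
  rewrite card_F pnatX; apply/orP; left.
  by rewrite pnatE // pchar_poly (card_finPcharP card_F).
rewrite exprDn_pchar // exprNn_pchar // expr1n -exprM; congr (1 - 'X^_).
by rewrite mulnBl -!expnSr.
Qed.

Lemma leq_expn_sub n m : (m < n)%N -> (n <= q ^ n - q ^ m)%N.
Proof.
case: n => // n; rewrite ltnS => le_mn.
apply: (@leq_trans (q ^ n)); first exact: ltn_expl.
rewrite leq_subRL ?leq_exp2l // ?leqW //.
apply: (@leq_trans (q ^ n + q ^ n)); first by rewrite leq_add2r leq_exp2l.
by rewrite addnn -mul2n expnS leq_mul2r q_gt1 orbT.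
Qed.

Lemma fps_eqmod1B N m (f : fps F) : (N <= m)%N ->
  fps_eqmod N (1 - fpsX F ^+ m * f) 1.
Proof.
move=> le_Nm; apply: fps_eqmodW le_Nm _; exists (- f).
by rewrite addrC addrA addNr sub0r mulrN.
Qed.

Lemma dbar_eqmod n : fps_eqmod n (poly_fps (dbar n)) 1.
Proof.
have E1 : \prod_(m < n) 1 = 1 :> fps F by rewrite big1_eq.
rewrite rmorph_prod -[X in fps_eqmod _ _ X]E1.
apply: fps_eqmod_prod => m; rewrite rmorphB rmorph1 rmorphXn /= poly_fpsX.
by rewrite -[_ ^+ _]mulr1; apply/fps_eqmod1B/leq_expn_sub.
Qed.

Definition gamma_trunc (d : nat -> nat) n : fps F :=
  \prod_(i < n) poly_fps (dbar i) ^+ d i.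

(** The exponents need not be digits below [q], which makes [gamma_fps] multiplicative in [d]
    without carries. *)
Definition gamma_fps d := fps_lim (gamma_trunc d).

Lemma gamma_fpsP d n : fps_eqmod n (gamma_fps d) (gamma_trunc d n).
Proof.
apply: (@fps_limP _ id) => // {}n; rewrite /gamma_trunc big_ord_recr /=.
rewrite -[X in fps_eqmod _ _ X]mulr1; apply: fps_eqmodM (fps_eqmod_refl _ _) _.
by rewrite -(expr1n _ (d n)); apply/fps_eqmodX/dbar_eqmod.
Qed.

Lemma gamma_fps_neq0 d : gamma_fps d != 0.
Proof.
apply/eqP => G0; have := gamma_fpsP d 1; rewrite G0 /gamma_trunc big_ord1.
rewrite /dbar big_ord0 rmorph1 expr1n => /fps_eqmodP/(_ 0%N isT) /eqP.
by rewrite eq_sym oner_eq0.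
Qed.

Lemma gamma_fps_prod (I : finType) (c : I -> nat) (d : I -> nat -> nat) :
  gamma_fps (fun i => \sum_k d k i * c k)%N = \prod_k gamma_fps (d k) ^+ c k.
Proof.
apply: fps_eqmod_eq => N; apply: fps_eqmod_trans (gamma_fpsP _ _) _.
rewrite /gamma_trunc /=; under eq_bigr => i _ do rewrite expr_sum.
rewrite exchange_big; apply: fps_eqmod_prod => k; apply: fps_eqmod_sym.
under eq_bigr => i _ do rewrite exprM.
by rewrite prodrXl; apply/fps_eqmodX/gamma_fpsP.
Qed.

Lemma Dbar_dbar n : Dbar F n = FracField.tofrac (poly_fps (dbar n)).
Proof.
have X0 : FracField.tofrac (fpsX F) != 0.
  rewrite tofrac_eq0; apply/eqP => /fpsP/(_ 1%N) /eqP.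
  by rewrite oner_eq0.
have constE : k_inf_const F =1 @FracField.tofrac (fps F) \o @poly_fps F \o polyC.
  by move=> c; congr FracField.tofrac; apply/fpsP => m; rewrite /= coefC.
have sizeXB m : (m < n)%N -> size ('X^(q ^ n) - 'X^(q ^ m) : {poly F}) = (q ^ n).+1.
  move=> lt_mn; rewrite size_polyDl ?size_polyN !size_polyXn //.
  by rewrite ltnS ltn_exp2l.
have sizeD : (size (D F n)).-1 = (q ^ n * n)%N.
  rewrite /D size_prod => [|m _]; last by rewrite -size_poly_eq0 sizeXB.
  under eq_bigr => m _ do rewrite sizeXB //.
  by rewrite sum_nat_const card_ord mulnS -addnS addKn mulnC.
rewrite /Dbar sizeD exprM.
have -> (x : k_inf F) : x ^+ n = \prod_(m < n) x by rewrite prodr_const card_ord.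
rewrite (eq_map_poly constE) /D rmorph_prod horner_prod -prodf_div !rmorph_prod.
apply: eq_bigr => m _; rewrite rmorphB /= !map_polyXn hornerD hornerN !hornerXn.
rewrite !rmorphB !rmorph1 /= !rmorphXn /= poly_fpsX /theta mulrBl. rewrite divff.
  rewrite !exprVn invrK mulrC expfB // ?ltn_exp2l //.
exact: (expf_neq0 _ (invr_neq0 X0)).
Qed.

Lemma arith_gammaE (r : padic_int p) d : digits q r = d ->
  arith_gamma F r = FracField.tofrac (gamma_fps d).
Proof.
move=> rd; rewrite /arith_gamma.
have truncE n : \prod_(i < n) Dbar F i ^+ digits q r i
    = FracField.tofrac (gamma_trunc d n).
  rewrite rmorph_prod rd; apply: eq_bigr => i _.
  by rewrite Dbar_dbar rmorphXn.
apply: xget_unique => [N|x xP].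
  exists N => n le_Nn; have [s sE] := fps_eqmodW le_Nn (fps_eqmod_sym (gamma_fpsP d n)).
  by exists s; rewrite truncE -rmorphB sE.
(* Order [0] already shows [x] to be a power series; the higher orders then determine it. *)
have [M /(_ M (leqnn M))[s sE]] := xP 0%N.
pose f := gamma_trunc d M - fpsX F ^+ 0 * s.
have xE : x = FracField.tofrac f by rewrite tofracB -sE -truncE subKr.
rewrite xE; congr FracField.tofrac.
apply: fps_eqmod_eq => N; have [M' /(_ (maxn N M') (leq_maxr _ _))] := xP N.
rewrite truncE xE -tofracB => -[s' /eqP]; rewrite tofrac_eq => /eqP sE'.
apply: fps_eqmod_trans (_ : fps_eqmod N (gamma_trunc d (maxn N M')) _).
  by apply: fps_eqmod_sym; exists s'.
exact: fps_eqmodW (leq_maxl N M') (fps_eqmod_sym (gamma_fpsP d _)).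
Qed.

(* The exponents [i = j] mod [l] are those of [(q ^ j / (1 - q ^ l))!]. *)
Section Periodic.
Variable l : nat.
Hypothesis l_gt0 : (0 < l)%N.

Definition omega j := gamma_fps (fun i => i == j %[mod l]).

Definition omega_ratio_trunc j n : {poly F} :=
  \prod_(i < n) (1 - 'X^(q ^ i.+1 - 1)) ^+ (i == j %[mod l]).

Definition omega_ratio j := fps_lim (fun n => poly_fps (omega_ratio_trunc j n)).

(** The omitted factors are [1] modulo [x ^ q ^ n]. This precision, and not merely [n], matters:
    with [l * n] for [n] it is the [x ^ Q ^ n] of Mahler's method. *)
Lemma omega_ratioP j n :
  fps_eqmod (q ^ n) (omega_ratio j) (poly_fps (omega_ratio_trunc j n)).
Proof.
apply: (@fps_limP _ (fun n => q ^ n)%N) => [i k le_ik|i|{}n].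
- by rewrite leq_exp2l.
- by rewrite ltnW // ltn_expl.
rewrite /omega_ratio_trunc big_ord_recr /= rmorphM.
rewrite -[X in fps_eqmod _ _ X]mulr1; apply: fps_eqmodM (fps_eqmod_refl _ _) _.
rewrite rmorphXn -[X in fps_eqmod _ _ X](expr1n _ (n == j %[mod l])); apply: fps_eqmodX.
rewrite rmorphB rmorph1 rmorphXn /= poly_fpsX -[_ ^+ (_ - _)]mulr1.
apply: fps_eqmod1B; rewrite subn1 -ltnS prednK ?expn_gt0 ?(ltnW q_gt1) //.
by rewrite ltn_exp2l.
Qed.

Lemma omegaS j : omega j.+1 = omega_ratio j * omega j ^+ q.
Proof.
have truncS n : gamma_trunc (fun i => i == j.+1 %[mod l]) n.+1
    = poly_fps (omega_ratio_trunc j n)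
      * gamma_trunc (fun i => i == j %[mod l]) n ^+ q.
  rewrite /gamma_trunc big_ord_recl {1}/dbar big_ord0 rmorph1 expr1n mul1r.
  rewrite -prodrXl rmorph_prod -big_split; apply: eq_bigr => i _ /=.
  rewrite /bump /= add1n -[i.+1]addn1 -[j.+1]addn1 eqn_modDr addn1 dbarS.
  by rewrite rmorphXn rmorphM exprMn rmorphXn -!exprM mulnC.
apply: fps_eqmod_eq => N.
apply: fps_eqmod_trans (fps_eqmodW (leqnSn N) (gamma_fpsP _ _)) _.
rewrite truncS; apply: fps_eqmodM; apply: fps_eqmod_sym.
  by apply: fps_eqmodW (omega_ratioP j N); rewrite ltnW // ltn_expl.
exact/fps_eqmodX/gamma_fpsP.
Qed.

Lemma omega_add j s : omega (j + s) =
  \prod_(t < s) omega_ratio (j + s - t.+1) ^+ (q ^ t) * omega j ^+ (q ^ s).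
Proof.
elim: s => [|s IHs]; first by rewrite addn0 big_ord0 mul1r.
rewrite addnS omegaS IHs big_ord_recl expn0 expr1 subn1 -mulrA; congr (_ * _).
rewrite exprMn -prodrXl -exprM -expnSr; congr (_ * _).
by apply: eq_bigr => t _; rewrite /= /bump /= add1n subSS -exprM -expnSr.
Qed.

Lemma eq_omega i j : i = j %[mod l] -> omega i = omega j.
Proof.
by move=> ij; congr gamma_fps; apply: functional_extensionality_dep => k; rewrite ij.
Qed.

Lemma eq_omega_ratio i j : i = j %[mod l] -> omega_ratio i = omega_ratio j.
Proof.
move=> ij; congr fps_lim; apply: functional_extensionality_dep => n.
by rewrite /omega_ratio_trunc ij.
Qed.

(* The exponent of [omega_ratio i] in [omega j ^- (q ^ l - 1)]. *)
Definition ratio_exp j i := (\sum_(t < l) (j == i + t.+1 %[mod l]) * q ^ t)%N.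

(** Taking [l] steps in [omega_add] returns to [omega j], one power of which cancels. *)
Lemma omega_expn j :
  \prod_(i < l) omega_ratio i ^+ ratio_exp j i * omega j ^+ (q ^ l - 1) = 1.
Proof.
apply: (mulfI (gamma_fps_neq0 (fun i => i == j %[mod l]))).
rewrite -/(omega j) mulr1 mulrCA -exprS subn1 prednK ?expn_gt0 ?(ltnW q_gt1) //.
rewrite -[RHS](@eq_omega (j + l)) ?modnDr // omega_add; congr (_ * _).
under eq_bigr => i _ do rewrite expr_sum.
rewrite exchange_big; apply: eq_bigr => t _ /=.
(* For given [t] exactly one [i] below [l] has [j = i + t.+1] mod [l]; adding [l] keeps the
   subtraction from being truncated. *)
have [i0 i0E] : exists i0 : 'I_l, i0 = ((j + l - t.+1) %% l)%N :> nat.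
  by exists (Ordinal (ltn_pmod (j + l - t.+1) l_gt0)).
have modE (i : 'I_l) : (j == i + t.+1 %[mod l]) = (i == i0).
  rewrite -(modnDr j l) -{1}(@subnK t.+1 (j + l)); last first.
    by rewrite (leq_trans (ltn_ord t)) // leq_addl.
  by rewrite eqn_modDr (modn_small (ltn_ord i)) eq_sym -i0E.
rewrite (bigD1 i0) //= big1 ?mulr1 => [|i neq_i]; last first.
  by rewrite modE (negbTE neq_i) mul0n expr0.
by rewrite modE eqxx mul1n; congr (_ ^+ _); apply: eq_omega_ratio; rewrite i0E modn_mod.
Qed.

(** Multiplication by [q] turns the term [t] of the sum for [i.+1] into the term [t.+1] of the sum
    for [i]; the two end terms carry the same congruence. *)
Lemma ratio_expS j i : (ratio_exp j i + (j == i.+1 %[mod l]) * q ^ l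
  = (j == i.+1 %[mod l]) + q * ratio_exp j i.+1)%N.
Proof.
rewrite /ratio_exp; case: l l_gt0 => // k _.
rewrite big_ord_recl big_ord_recr /= expn0 muln1 addn1 -!addnA; congr (_ + _)%N.
rewrite mulnDr big_distrr /= addSnnS -[(i + k.+2)%N]addSnnS modnDr.
congr (_ + _)%N; last by rewrite expnS mulnCA.
by apply: eq_bigr => t _; rewrite /bump /= add1n addSnnS expnS mulnCA.
Qed.

Lemma omega_ratio_truncM (i : 'I_l) n : omega_ratio_trunc i (l * n)
  = \prod_(b < n) (1 - 'X^(q ^ (i.+1 + l * b) - 1)).
Proof.
elim: n => [|n IHn]; first by rewrite muln0 /omega_ratio_trunc !big_ord0.
rewrite mulnSr big_ord_recr -IHn /omega_ratio_trunc big_split_ord /=.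
congr (_ * _); rewrite (bigD1 i) //= big1 ?mulr1 => [|t neq_ti].
  by rewrite mulnC modnMDl eqxx expr1 -addnS addnC.
by rewrite mulnC modnMDl !modn_small // val_eqE (negbTE neq_ti).
Qed.

(** The exponent of [omega_ratio i] in the product of the [omega j ^- ((q ^ l - 1) * s j)]. *)
Definition monomial_exp (s : 'I_l -> nat) i := (\sum_(j < l) ratio_exp j i * s j)%N.

(** [ratio_expS] inverts the system: [q] times the exponent at [j0], minus the exponent at its
    predecessor mod [l], is [s j0 * (q ^ l - 1)]. *)
Lemma monomial_exp_inj s s' :
  (forall i : 'I_l, monomial_exp s i = monomial_exp s' i) -> s =1 s'.
Proof.
move=> eq_ss' j0.
have eq_exp i : monomial_exp s i = monomial_exp s' i.
  have := eq_ss' (Ordinal (ltn_pmod i l_gt0)); rewrite /monomial_exp /ratio_exp /=.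
  under eq_bigr => j _ do under eq_bigr => t _ do rewrite modnDml.
  by under [RHS]eq_bigr => j _ do under eq_bigr => t _ do rewrite modnDml.
(* [j0 + l.-1] stands for [j0 - 1] mod [l], so that [ratio_expS] singles out [j = j0]. *)
have recE (r : 'I_l -> nat) :
    (monomial_exp r (j0 + l.-1) + r j0 * q ^ l
      = r j0 + q * monomial_exp r (j0 + l.-1).+1)%N.
  have rE : (\sum_(j < l) (j == (j0 + l.-1).+1 %[mod l]) * r j)%N = r j0.
    rewrite -addnS prednK // modnDr (bigD1 j0) //= eqxx mul1n big1 ?addn0 //.
    by move=> j neq_j; rewrite !modn_small // val_eqE (negbTE neq_j).
  rewrite -rE /monomial_exp big_distrl big_distrr -!big_split; apply: eq_bigr => j _ /=.
  by rewrite mulnAC -mulnDl ratio_expS mulnDl mulnA.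
have Q_gt1 : (1 < q ^ l)%N by rewrite -(exp1n l) ltn_exp2r.
have cancelE (r : 'I_l -> nat) : (monomial_exp r (j0 + l.-1) + r j0 * (q ^ l).-1
    = q * monomial_exp r (j0 + l.-1).+1)%N.
  apply/eqP; rewrite -(eqn_add2l (r j0)) -recE addnCA -mulnS prednK //.
  exact: ltnW.
have := cancelE s; rewrite !eq_exp -cancelE => /eqP; rewrite eqn_add2l.
by rewrite eqn_pmul2r ?ltn_predRL // => /eqP.
Qed.

Theorem omega_indep (P : {mpoly {poly F}[l]}) :
  mmap (@poly_fps F) (fun j => omega j ^+ (q ^ l - 1)) P = 0 -> P = 0.
Proof.
pose k := msize P; pose I : finType := 'X_{1..l < k}.
(* Multiplying by the [k]-th powers of the inverses [V j] of [omega j ^ (q ^ l - 1)] turns the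
   exponents [m j] into [k - m j] for [V j], so that only products of the [omega_ratio i] remain. *)
pose mu (m : I) (i : 'I_l) := monomial_exp (fun j => k - (m : 'X_{1..l}) j)%N i.
have le_mk (m : I) j : ((m : 'X_{1..l}) j <= k)%N.
  by apply: leq_trans (ltnW (bmdeg m)); rewrite mdegE (bigD1 j) //= leq_addr.
rewrite (@mmapE _ _ _ _ _ _ k) // => P0.
suff c0 (m : I) : P@_m = 0.
  by rewrite [P](mpolywE (k := k)) // big1 // => m _; rewrite c0 scale0r.
move: m; apply: (@gamma_mahler F q l (\sum_m \sum_i mu m i) I mu) => //.
- by move=> m; rewrite (bigD1 m) //= leq_addr.
- move=> m m' neq_m; apply: contrapT => no_i; case/eqP: neq_m.
  have eq_mu (i : 'I_l) : mu m i = mu m' i.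
    by apply/eqP; apply: contrapT => /negP neq_i; apply: no_i; exists i.
  apply/val_inj/mnmP => j; have /= := monomial_exp_inj eq_mu j => eq_j.
  by rewrite -(subKn (le_mk m j)) -(subKn (le_mk m' j)) eq_j.
move=> n; apply: poly_fps_eqmod0; rewrite -expnM.
pose V (j : 'I_l) := \prod_(i < l) omega_ratio i ^+ ratio_exp j i.
have VE (m : I) : \prod_(i < l) omega_ratio i ^+ mu m i
    = \prod_(j < l) V j ^+ k * \prod_(j < l) (omega j ^+ (q ^ l - 1)) ^+ (m : 'X_{1..l}) j.
  rewrite -big_split /=; transitivity (\prod_(j < l) V j ^+ (k - (m : 'X_{1..l}) j)).
    under eq_bigr => i _ do rewrite /mu /monomial_exp expr_sum.
    rewrite exchange_big; apply: eq_bigr => j _.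
    by rewrite /V -prodrXl; apply: eq_bigr => i _; rewrite exprM.
  apply: eq_bigr => j _; set mj := (m : 'X_{1..l}) j.
  have -> : V j ^+ k = V j ^+ (k - mj) * V j ^+ mj by rewrite -exprD subnK ?le_mk.
  rewrite -mulrA -exprMn.
  by rewrite /V omega_expn expr1n mulr1.
have PW0 : \sum_m poly_fps P@_(m : I) * \prod_(i < l) omega_ratio i ^+ mu m i = 0.
  rewrite -[RHS](mulr0 (\prod_(j < l) V j ^+ k)) -[X in _ = _ * X]P0 mulr_sumr.
  by apply: eq_bigr => m _; rewrite VE mulrCA.
rewrite -PW0 rmorph_sum; apply: fps_eqmod_sum => m; rewrite rmorphM.
apply: fps_eqmodM (fps_eqmod_refl _ _) _; rewrite rmorph_prod.
apply: fps_eqmod_prod => i; rewrite rmorphXn; apply: fps_eqmodX.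
by rewrite -omega_ratio_truncM; apply/fps_eqmod_sym/omega_ratioP.
Qed.

End Periodic.

End GammaSeries.

(** * Digits of [c / (1 - q ^ l)] *)

Section PadicDigits.
Variables (p e : nat).
Hypotheses (p_prime : prime p) (e_gt0 : (0 < e)%N).
Implicit Types (r : padic_int p).

Local Notation q := (p ^ e)%N.

Let q_gt1 : (1 < q)%N.
Proof. by rewrite -(exp1n e) ltn_exp2r // prime_gt1. Qed.

Lemma padic_res_add r s n :
  padic_res (r + s) n = ((padic_res r n + padic_res s n) %% (p ^ n)%N%:Z)%Z.
Proof. by []. Qed.

Lemma padic_res_mul r s n :
  padic_res (r * s) n = ((padic_res r n * padic_res s n) %% (p ^ n)%N%:Z)%Z.
Proof. by []. Qed.

Lemma padic_res1 n : padic_res (1 : padic_int p) n = (1 %% (p ^ n)%N%:Z)%Z.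
Proof. by []. Qed.

Lemma padic_res_nat k n : padic_res (k%:R : padic_int p) n = (k %% p ^ n)%N.
Proof.
elim: k => [|k IHk]; first by rewrite mod0n; apply: mod0z.
rewrite mulrSr padic_res_add padic_res1 IHk -modz_nat modzDm -modz_nat.
by rewrite -PoszD addn1.
Qed.

(** The geometric series for the inverse of [1 - Q]: the terms from [Q ^ n] on vanish mod [p ^ n]
    when [p] divides [Q]. *)
Definition geom_inv_res Q n : int := ((\sum_(i < n) Q ^ i) %% p ^ n)%N.

Lemma geom_inv_coherent Q : (p %| Q)%N ->
  `[< padic_coherent p (geom_inv_res Q) >].
Proof.
move=> dvd_pQ; apply/asboolP => n; rewrite /geom_inv_res modz_nat; congr Posz.
rewrite modn_dvdm ?dvdn_exp2l // big_ord_recr -modnDmr /=.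
by rewrite (eqP (dvdn_exp2r n dvd_pQ)) addn0.
Qed.

Lemma padic_sub1_inv Q : (p %| Q)%N ->
  exists s : padic_int p, s * (1 - Q%:R) = 1.
Proof.
move=> dvd_pQ; exists (PadicInt (geom_inv_coherent dvd_pQ)); set s := PadicInt _.
suff sE : s = 1 + Q%:R * s by rewrite mulrBr mulr1 {1}sE [s * _]mulrC addrK.
apply/padicP => n; rewrite padic_res_add padic_res_mul padic_res_nat padic_res1.
rewrite modzDm -[padic_res s n]/(Posz ((\sum_(i < n) Q ^ i) %% p ^ n)).
rewrite -PoszM -[1]/(Posz 1) -PoszD modz_nat; congr Posz.
rewrite -[RHS]modnDmr modnMm modnDmr.
have -> : (1 + Q * \sum_(i < n) Q ^ i = \sum_(i < n) Q ^ i + Q ^ n)%N.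
  transitivity (\sum_(i < n.+1) Q ^ i)%N; last by rewrite big_ord_recr.
  rewrite big_ord_recl big_distrr expn0; congr (_ + _)%N.
  by apply: eq_bigr => i _; rewrite /= /bump add1n expnS.
by rewrite -modnDmr (eqP (dvdn_exp2r n dvd_pQ)) addn0.
Qed.

(** [padic_of_rat] works in lowest terms; [c] and [1 - Q] are the same integer multiple [t] of the
    reduced numerator and denominator. *)
Lemma padic_of_ratP (c Q : nat) : (p %| Q)%N ->
  padic_of_rat p (c%:R / (1 - Q%:R)) * (1 - Q%:R) = c%:R.
Proof.
move=> dvd_pQ; set x := c%:R / _ : rat.
have Q_neq1 : Q != 1%N.
  by apply: contraTneq dvd_pQ => ->; rewrite Euclid_dvd1.
have numE : numq x * (1 - Q%:Z) = c%:Z * denq x.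
  apply/eqP; rewrite -(eqr_int rat) !rmorphM /= numqE /x rmorphB /=.
  rewrite mulrAC mulfVK // subr_eq0 eq_sym.
  by rewrite Num.Theory.pnatr_eq1.
have [t QE] : exists t, 1 - Q%:Z = denq x * t.
  have : (denq x %| numq x * (1 - Q%:Z))%Z by rewrite numE dvdz_mull.
  rewrite Gauss_dvdzr; last by rewrite coprimezE coprime_sym coprime_num_den.
  by move=> /dvdzP[t ->]; exists t; rewrite mulrC.
have cE : c%:Z = numq x * t.
  by apply: (mulIf (denq_neq0 x)); rewrite -numE QE [denq x * t]mulrC mulrA.
have QR : 1 - Q%:R = (denq x)%:~R * t%:~R :> padic_int p.
  by rewrite -rmorphM -QE rmorphB.
have cR : c%:R = (numq x)%:~R * t%:~R :> padic_int p.
  by rewrite -rmorphM -cE.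
rewrite /padic_of_rat; case: xgetP => [r _ rE|no_r].
  by rewrite QR cR mulrA rE.
(* The default value is excluded: [c] times the inverse of [1 - Q] meets the condition. *)
have [s sE] := padic_sub1_inv dvd_pQ.
have /no_r[] : (c%:R * s) * (denq x)%:~R = (numq x)%:~R.
rewrite cR -!mulrA [t%:~R * _]mulrC -mulrA -[s * _]mulrC.
by rewrite -QR [_ * s]mulrC sE mulr1.
Qed.

(** The partial sum of the first [n] terms is the residue mod [q ^ n] of all later ones, and
    convergence makes these residues agree. *)
Lemma expansion_uniq r d d' :
  is_expansion q r d -> is_expansion q r d' -> d = d'.
Proof.
move=> [d_lt rd] [d'_lt rd'].
pose S (u : nat -> nat) n := (\sum_(i < n) u i * q ^ i)%N.
have S_mod u n m : (forall i, (u i < q)%N) -> (n <= m)%N ->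
    (S u m %% q ^ n)%N = S u n.
  move=> u_lt /subnKC <-.
  have S_lt : (S u n < q ^ n)%N.
    elim: n => [|n IHn]; first by rewrite /S big_ord0.
    rewrite /S big_ord_recr /= expnS; apply: (@leq_trans ((u n).+1 * q ^ n)).
      by rewrite mulSn ltn_add2r.
    by rewrite leq_mul2r u_lt orbT.
  rewrite /S big_split_ord /= -modnDmr.
  have /eqP -> : (q ^ n %| \sum_(i < m - n) u (n + i) * q ^ (n + i))%N.
    by apply: dvdn_sum => i _; rewrite [(q ^ (n + _))%N]expnD mulnCA dvdn_mulr.
  by rewrite addn0 modn_small.
have eqS n : S d n = S d' n.
  have [M MP] := rd (e * n)%N; have [M' M'P] := rd' (e * n)%N.
  pose m := maxn n (maxn M M').
  have [s sE] := MP m (leq_trans (leq_maxl _ _) (leq_maxr _ _)).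
  have [s' s'E] := M'P m (leq_trans (leq_maxr _ _) (leq_maxr _ _)).
  have SE : (S d m)%:R = (S d' m)%:R + (q ^ n)%N%:R * (s - s') :> padic_int p.
    have addK (V : zmodType) (x y z : V) : x = y + ((x - z) - (y - z)).
      by rewrite opprB subrKA addrC subrK.
    by rewrite -expnM natrX mulrBr -sE -s'E /S !natr_sum -addK.
  have := congr1 (fun x : padic_int p => padic_res x (e * n)) SE.
  rewrite padic_res_add padic_res_mul !padic_res_nat expnM modnn mul0r mod0z.
  by rewrite addr0 modz_nat modn_mod !S_mod ?leq_maxl // => -[].
apply: functional_extensionality_dep => n; have := eqS n.+1.
rewrite /S !big_ord_recr /= -/(S d n) -/(S d' n) eqS => /eqP.
by rewrite eqn_add2l eqn_pmul2r ?expn_gt0 ?prime_gt0 // => /eqP.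
Qed.

(** As [r = c + q ^ l * r], the expansion repeats the [l] digits of [c]. *)
Lemma digits_periodic l c r : (0 < l)%N -> (c < q ^ l)%N ->
  r * (1 - (q ^ l)%:R) = c%:R ->
  digits q r = fun i => (c %/ q ^ (i %% l) %% q)%N.
Proof.
move=> l_gt0 lt_c rE; set d := fun i : nat => _.
have r_rec : r = c%:R + (q ^ l)%:R * r by rewrite -rE mulrBr mulr1 mulrC subrK.
pose S n := (\sum_(i < n) d i * q ^ i)%N.
have Sc n : (\sum_(i < n) (c %/ q ^ i %% q) * q ^ i = c %% q ^ n)%N.
  elim: n => [|n IHn]; first by rewrite big_ord0 modn1.
  have cE : c = (c %/ q ^ n %/ q * q ^ n.+1
      + (c %/ q ^ n %% q * q ^ n + c %% q ^ n))%N.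
    by rewrite expnS mulnA addnA -mulnDl -!divn_eq.
  rewrite big_ord_recr IHn /= addnC [X in (X %% q ^ n.+1)%N]cE modnMDl.
  rewrite (@modn_small (_ + _)) //; apply: (@leq_trans ((c %/ q ^ n %% q).+1 * q ^ n)).
    by rewrite mulSn addnC ltn_add2r ltn_pmod // !expn_gt0 prime_gt0.
  by rewrite expnS leq_mul2r ltn_pmod ?orbT // expn_gt0 prime_gt0.
have S_rec n : S (l + n)%N = (c + q ^ l * S n)%N.
  rewrite /S big_split_ord /=; congr (_ + _)%N.
    rewrite -[RHS](modn_small lt_c) -Sc; apply: eq_bigr => i _.
    by rewrite /d (modn_small (ltn_ord i)).
  rewrite big_distrr; apply: eq_bigr => i _ /=.
  by rewrite /d modnDl expnD mulnCA.
have S_approx k n : exists t : padic_int p,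
    (S (k * l + n)%N)%:R - r = (q ^ l)%:R ^+ k * t.
  elim: k => [|k [t tE]]; first by exists ((S n)%:R - r); rewrite expr0 mul1r mul0n add0n.
  exists t; rewrite mulSn -addnA S_rec {1}r_rec natrD natrM opprD addrACA subrr.
  by rewrite add0r -mulrBr tE exprS mulrA.
have dP : is_expansion q r d.
  split=> [i|N]; first by rewrite /d ltn_pmod // expn_gt0 prime_gt0.
  exists (N * l)%N => n le_n; have [t tE] := S_approx N (n - N * l)%N.
  exists (p%:R ^+ (e * l * N - N) * t); rewrite subnKC // in tE.
  rewrite -natr_sum tE mulrA -exprD subnKC ?leq_pmull ?muln_gt0 ?e_gt0 //.
  by rewrite -expnM natrX -exprM.
by apply: xget_unique => // d' d'P; apply: expansion_uniq d'P dP.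
Qed.

End PadicDigits.

(** * The transcendence degree *)

Section GammaValues.
Variables (p e l : nat) (F : finFieldType).
Hypotheses (p_prime : prime p) (e_gt0 : (0 < e)%N) (l_gt0 : (0 < l)%N).
Hypothesis card_F : #|F| = (p ^ e)%N.

Local Notation q := #|F|.
Local Notation tofrac := (@FracField.tofrac (fps F)).

Let q_gt1 : (1 < q)%N.
Proof. by rewrite card_F -(exp1n e) ltn_exp2r // prime_gt1. Qed.

Let Q_gt1 : (1 < q ^ l)%N.
Proof. by rewrite -(exp1n l) ltn_exp2r. Qed.

(** The digit sequence is split by residue class mod [l], each class contributing a power of one
    [omega j]. *)
Lemma arith_gamma_periodic c (r : padic_int p) : (c < q ^ l)%N ->
  r * (1 - (q ^ l)%:R) = c%:R ->
  arith_gamma F r = tofrac (\prod_(j < l) omega F l j ^+ (c %/ q ^ j %% q)).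
Proof.
rewrite {1 2}card_F => lt_c /(digits_periodic p_prime e_gt0 l_gt0 lt_c).
rewrite -card_F => /(arith_gammaE p_prime e_gt0 card_F) ->.
rewrite -(gamma_fps_prod p_prime e_gt0 card_F); congr (tofrac (gamma_fps _ _)).
apply: functional_extensionality_dep => i.
rewrite (bigD1 (Ordinal (ltn_pmod i l_gt0))) //= modn_mod eqxx mul1n.
rewrite big1 ?addn0 // => j neq_j; rewrite (modn_small (ltn_ord j)).
have -> : (i %% l == j)%N = false by rewrite eq_sym; apply/negbTE.
by rewrite mul0n.
Qed.

Lemma arith_gamma_omega (j : 'I_l) (r : padic_int p) :
  r * (1 - (q ^ l)%:R) = (q ^ j)%:R -> arith_gamma F r = tofrac (omega F l j).
Proof.
move=> /arith_gamma_periodic ->; last by rewrite ltn_exp2l.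
congr tofrac; rewrite (bigD1 j) //= divnn expn_gt0 (ltnW q_gt1) modn_small // expr1.
rewrite big1 ?mulr1 // => i neq_i; rewrite [X in _ ^+ X](_ : _ = 0%N) //.
have [lt_ij|] := ltnP i j.
  by rewrite -expnB ?(ltnW q_gt1) 1?ltnW // -(subnSK lt_ij) expnS modnMr.
rewrite leq_eqVlt eq_sym (negbTE (neq_i : i != j :> nat)) /= => lt_ji.
by rewrite divn_small ?mod0n // ltn_exp2l.
Qed.

Lemma padic_of_rat_gamma c :
  padic_of_rat p (c%:R / (1 - q%:R ^+ l)) * (1 - (q ^ l)%:R) = c%:R.
Proof.
rewrite -natrX padic_of_ratP // -(prednK l_gt0) expnS dvdn_mulr // card_F.
by rewrite -(prednK e_gt0) expnS dvdn_mulr.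
Qed.

Lemma omega_gamma_values (j : 'I_l) : gamma_values F p l (tofrac (omega F l j)).
Proof.
rewrite /gamma_values; case: ifPn => [/andP[/eqP q2 /eqP l1]|].
  rewrite (@arith_gamma_omega j) //.
  have -> : j = 0%N :> nat by case: j => -[|m] //=; rewrite l1.
  by rewrite q2 l1 expn0 mulN1r opprB [X in X - _](_ : _ = 1 + 1) ?addrK // natrD.
rewrite negb_and => q2_l1; exists (q ^ j)%N; last first.
  exact: arith_gamma_omega (padic_of_rat_gamma _).
rewrite /= expn_gt0 (ltnW q_gt1) /=.
(* It remains that [2 + q ^ l.-1 <= q ^ l], which fails only for [q = 2] and [l = 1]. *)
have le_j : (q ^ j <= q ^ l.-1)%N by rewrite leq_exp2l // -ltnS prednK.
apply: leq_trans le_j _; rewrite leq_subRL // -{2}(prednK l_gt0) expnS.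
have [q2|q3] := ltnP 2 q.
  apply: (@leq_trans (3 * q ^ l.-1)); last by rewrite leq_mul2r q2 orbT.
  by rewrite mulSn addnC leq_add2l leq_pmulr // expn_gt0 ltnW.
have q2 : q = 2%N by apply/eqP; rewrite eqn_leq q3.
move: q2_l1; rewrite {1}q2 eqxx /= => l1.
rewrite q2 mul2n -addnn leq_add2r (@leq_exp2l 2 1) //.
by rewrite -ltnS prednK // ltn_neqAle eq_sym l1.
Qed.

Lemma gamma_values_sub (x : k_inf F) : gamma_values F p l x ->
  exists c : 'I_l -> nat, x = \prod_(j < l) tofrac (omega F l j) ^+ c j.
Proof.
have prodE (c : 'I_l -> nat) :
    tofrac (\prod_(j < l) omega F l j ^+ c j) = \prod_(j < l) tofrac (omega F l j) ^+ c j.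
  by rewrite rmorph_prod; apply: eq_bigr => j _; rewrite rmorphXn.
rewrite /gamma_values; case: ifP => [/andP[/eqP q2 /eqP l1] ->|_ [c /= /andP[_ le_c] <-]].
  exists (fun j : 'I_l => 1 %/ q ^ j %% q)%N; rewrite -prodE.
  apply: arith_gamma_periodic => //; rewrite q2 l1.
  by rewrite mulN1r opprB [X in X - _](_ : _ = 1 + 1) ?addrK // natrD.
exists (fun j : 'I_l => c %/ q ^ j %% q)%N; rewrite -prodE.
apply: arith_gamma_periodic (padic_of_rat_gamma c).
by apply: leq_ltn_trans le_c _; rewrite ltn_subrL (ltnW Q_gt1).
Qed.

End GammaValues.

Section TranscendenceDegree.
Variables (p e l : nat) (F : finFieldType).
Hypotheses (p_prime : prime p) (e_gt0 : (0 < e)%N) (l_gt0 : (0 < l)%N).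
Hypothesis card_F : #|F| = (p ^ e)%N.
Variables (C : fieldType) (iota : {rmorphism k_inf F -> C}).

Local Notation q := #|F|.
Local Notation tofrac := (@FracField.tofrac (fps F)).

Let b (j : 'I_l) : C := iota (tofrac (omega F l j)).

Let phi : {rmorphism {poly F} -> C} := iota \o tofrac \o @poly_fps F.

Lemma omega_pow_indep (P : {mpoly {poly F}[l]}) :
  mmap phi (fun j => b j ^+ (q ^ l - 1)) P = 0 -> P = 0.
Proof.
move=> P0; apply: (omega_indep p_prime e_gt0 card_F l_gt0).
apply/eqP; rewrite -tofrac_eq0 -(fmorph_eq0 iota); apply/eqP.
rewrite -[RHS]P0 /mmap !rmorph_sum; apply: eq_bigr => m _.
rewrite !rmorphM; congr (_ * _); rewrite /mmap1 !rmorph_prod.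
by apply: eq_bigr => j _; rewrite !rmorphXn.
Qed.

(** The range of [phi] contains the constants and the inverse of [theta], which generate [k_rat]. *)
Lemma kbar_sub_alg_closure (A : set C) x :
  range phi `<=` A -> kbar iota x -> x \in alg_closure A.
Proof.
move=> phiA; apply: algebraic_over_alg_closure => _ [y ky <-] /=.
suff : [set y | iota y \in alg_closure A] y by [].
move: y ky; apply: field_gen_sub.
  split=> [|y z|y z]; rewrite !inE /= ?rmorph1 ?rmorphB ?fmorph_div.
  - exact: rpred1.
  - exact: rpredB.
  - exact: rpred_div.
move=> y [[c _ <-]|->] /=.
  apply/sub_alg_closure/phiA; exists c%:P => //=; congr (iota (tofrac _)).
  by apply/fpsP => n; rewrite /= coefC.
rewrite /theta fmorphV rpredV; apply/sub_alg_closure/phiA; exists 'X => //=.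
by rewrite poly_fpsX.
Qed.

(** A relation over [kbar] makes some [b i] algebraic over [kbar] and the other [b j]. These are
    algebraic over the range of [phi] and the other [u j], so [u i] would be too, against
    [omega_pow_indep]. *)
Lemma omega_alg_independent : alg_independent (kbar iota) b.
Proof.
move=> P PK Pb; apply/eqP; apply: contraT => P0.
have [i iP] := alg_dependent P0 Pb.
pose u (j : 'I_l) := b j ^+ (q ^ l - 1).
have q_gt1 : (1 < q)%N by rewrite card_F -(exp1n e) ltn_exp2r // prime_gt1.
have Q_gt1 : (1 < q ^ l)%N by rewrite -(exp1n l) ltn_exp2r.
have /negP[] := not_algebraic_of_independent i omega_pow_indep.
apply/rpredX/iP => [m|j neq_ji].
  have [m_P|/memN_msupp_eq0 ->] := boolP (m \in msupp P); last exact: rpred0.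
  apply: kbar_sub_alg_closure; first by move=> x; left.
  by have := allP PK _ (map_f _ m_P); rewrite inE.
have uj : u j \in alg_closure
    (range phi `|` [set u j | j in [set j | j != i]]).
  by apply: sub_alg_closure; right; exists j.
apply: (@alg_closure_root _ _ ('X^(q ^ l - 1) - (u j)%:P)).
- by rewrite -size_poly_eq0 size_XnsubC ?subn_gt0.
- by rewrite rpredB ?polyOverXn ?polyOverC.
- by rewrite rootE !hornerE subrr.
Qed.

End TranscendenceDegree.

Theorem corollary3p3p3 (p e q : nat) (p_prime : prime p) (e_gt0 : (0 < e)%N)
  (q_def : q = (p ^ e)%N) (F : finFieldType) (card_F : #|F| = q)
  (C : closedFieldType) (iota : {rmorphism k_inf F -> C})
  (C_alg : forall x : C, algebraicOver iota x)
  (l : nat) (l_gt0 : (0 < l)%N) :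
  has_trdeg (kbar iota)
    (field_gen (kbar iota `|` iota @` gamma_values F p l)) l.
Proof.
subst q; pose b (j : 'I_l) := iota (FracField.tofrac (omega F l j)).
exists b; split.
- move=> j; apply: sub_field_gen; right; exists (FracField.tofrac (omega F l j)) => //.
  exact: (omega_gamma_values p_prime e_gt0 l_gt0 card_F).
- exact: (omega_alg_independent p_prime e_gt0 l_gt0 card_F).
(* The gamma values are monomials in the [b j], so [x] lies in the field generated by these over
   [kbar] and a linear polynomial suffices. *)
move=> x Lx; have Kbx : field_gen (kbar iota `|` range b) x.
  apply: field_gen_sub Lx; first exact: field_gen_divring.
  move=> y [Ky|[z /(gamma_values_sub p_prime e_gt0 l_gt0 card_F)[c ->] <-]].
    by apply: sub_field_gen; left.
  suff : iota (\prod_(j < l) FracField.tofrac (omega F l j) ^+ c j)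
    \in field_gen_pred (kbar iota `|` range b) by rewrite inE.
  rewrite rmorph_prod rpred_prod // => j _; rewrite rmorphXn rpredX // inE.
  by apply: sub_field_gen; right; exists j.
exists ('X - x%:P); split; [by rewrite polyXsubC_eq0| |by rewrite root_XsubC].
have : 'X - x%:P \is a polyOver (field_gen_pred (kbar iota `|` range b)).
  by rewrite polyOverXsubC inE.
by [].
Qed.
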